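(* Let $\mathfrak h$ be a $d$-dimensional abelian Lie algebra over $\mathbb C$ with a nondegenerate symmetric bilinear form $\langle\cdot,\cdot\rangle$, let $\nu$ be an isometry of $\mathfrak h$ with $\nu^p=1$ ($p\ge1$) preserving a rational lattice in $\mathfrak h$, and let $\bar L^{\nu;y_1,y_2}\langle x\rangle$ be the formal series of operators on $S[\nu]$ $$\bar L^{\nu;y_1,y_2}\langle x\rangle=\frac12\sum_{q=1}^d{:}\alpha_q^\nu\langle e^{y_1}x\rangle\,\alpha_q^\nu\langle e^{y_2}x\rangle{:}-\frac12\frac{\partial}{\partial y_1}\Bigg(\sum_{k=0}^{p-1}\frac{e^{\frac{k(-y_1+y_2)}p}\dim\mathfrak h_{(k)}}{1-e^{-y_1+y_2}}\Bigg).$$ Then $$[\bar L^{\nu;y_1,y_2}\langle x_1\rangle,\bar L^{\nu;y_3,y_4}\langle x_2\rangle]$$ $$=-\frac12\frac{\partial}{\partial y_1}\Big(\bar L^{\nu;-y_1+y_2+y_3,\,y_4}\langle x_2\rangle\,\delta\Big(\frac{e^{y_1}x_1}{e^{y_3}x_2}\Big)+\bar L^{\nu;-y_1+y_2+y_4,\,y_3}\langle x_2\rangle\,\delta\Big(\frac{e^{y_1}x_1}{e^{y_4}x_2}\Big)\Big)$$ $$\quad-\frac12\frac{\partial}{\partial y_2}\Big(\bar L^{\nu;y_1-y_2+y_3,\,y_4}\langle x_2\rangle\,\delta\Big(\frac{e^{y_2}x_1}{e^{y_3}x_2}\Big)+\bar L^{\nu;y_1-y_2+y_4,\,y_3}\langle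 x_2\rangle\,\delta\Big(\frac{e^{y_2}x_1}{e^{y_4}x_2}\Big)\Big).$$
   Context: Fix a primitive $p$-th root of unity $\omega_p$. For $r\in\mathbb Z$, $\mathfrak h_{(r)}=\{\alpha\in\mathfrak h:\nu\alpha=\omega_p^r\alpha\}$ and $\alpha_{(r)}$ is the projection of $\alpha\in\mathfrak h$ on $\mathfrak h_{(r)}$. The $\nu$-twisted affine Lie algebra is $\hat{\mathfrak h}[\nu]=\coprod_{n\in\frac1p\mathbb Z}\mathfrak h_{(pn)}\otimes t^n\oplus\mathbb CC$ with $C$ central and $[\alpha\otimes t^m,\beta\otimes t^n]=\langle\alpha,\beta\rangle m\,\delta_{m+n,0}C$ for $\alpha\in\mathfrak h_{(pm)}$, $\beta\in\mathfrak h_{(pn)}$. With $\hat{\mathfrak h}[\nu]^{\pm}=\coprod_{\pm n>0}\mathfrak h_{(pn)}\otimes t^n$, $S[\nu]=\mathcal U(\hat{\mathfrak h}[\nu])\otimes_{\mathcal U(\hat{\mathfrak h}[\nu]^+\oplus\mathfrak h_{(0)}\oplus\mathbb CC)}\mathbb C\simeq S(\hat{\mathfrak h}[\nu]^-)$, where $\hat{\mathfrak h}[\nu]^+\oplus\mathfrak h_{(0)}$ acts trivially on $\mathbb C$ and $C$ acts as $1$. For $\alpha\in\mathfrak h$ and $n\in\frac1p\mathbb Z$, $\alpha^\nu(n)$ is the action of $\alpha_{(pn)}\otimes t^n$ on $S[\nu]$, and $\alpha^\nu\langle x\rangle=\sum_{n\in\frac1p\mathbb Z}\alpha^\nu(n)x^{-n}$.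 $\{\alpha_q\}_{q=1}^d$ is an orthonormal basis of $\mathfrak h$. The normal ordering ${:}\cdot{:}$ places $\alpha^\nu(n)$ with $n>0$ to the right. $\delta(x)=\sum_{n\in\mathbb Z}x^n$. The lattice assumption (a rational lattice, i.e. a free abelian group spanning $\mathfrak h$ with rational-valued form, preserved by $\nu$) is a standing assumption. Expansion conventions: $\frac{1}{1-e^{-y_1+y_2}}$ means $(y_1-y_2)^{-1}$ times a formal power series in $y_1,y_2$, with $(y_1-y_2)^{-1}$ expanded in nonnegative powers of $y_2$. Thus $\bar L^{\nu;y_1,y_2}\langle x\rangle$ equals $\frac12\frac{d}{(y_1-y_2)^2}$ plus a series with only nonnegative powers of $y_1,y_2$. On the right-hand side of the bracket formula the negative powers of $\pm(y_1-y_2-y_3+y_4)$ and $\pm(y_1-y_2+y_3-y_4)$ that occur are all expanded in negative powers of $y_1$ and nonnegative powers of $y_2,y_3,y_4$. *)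

(* Defs.v *)
From HB Require Import structures.
From mathcomp Require Import all_boot all_order all_algebra.
From mathcomp Require Import mathcomp_extra boolp classical_sets functions.
From mathcomp Require Import cardinality fsbigop.
From mathcomp Require Import zify ring.
From mathcomp.multinomials Require Import monalg.

Set Implicit Arguments.
Unset Strict Implicit.
Unset Printing Implicit Defensive.

Import Order.TTheory GRing.Theory Num.Theory.

Local Open Scope classical_set_scope.
Local Open Scope ring_scope.
Local Open Scope quotient_scope.

Section LinearSpan.
Variables (K : fieldType) (V : lmodType K) (S : set V).

Definition linspan : {pred V} :=
  [pred v | `[< forall W : submodClosed V,
                  (forall s, S s -> s \in (W : {pred V})) -> v \in (W : {pred V}) >]].

Lemma linspanP v :
  reflect (forall W : submodClosed V,
             (forall s, S s -> s \in (W : {pred V})) -> v \in (W : {pred V}))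
          (v \in linspan).
Proof. exact: asboolP. Qed.

Fact linspan_submod : submod_closed linspan.
Proof.
split=> [|a u v /linspanP hu /linspanP hv]; apply/linspanP => W hW.
  exact: rpred0.
by rewrite rpredD ?rpredZ ?hu ?hv.
Qed.

HB.instance Definition _ := GRing.isSubmodClosed.Build K V linspan
  linspan_submod.

Lemma mem_linspan s : S s -> s \in linspan.
Proof. by move=> Ss; apply/linspanP => W; apply. Qed.

Definition lquot := {ideal_quot linspan}.

HB.instance Definition _ := GRing.Zmodule.on lquot.

Definition lpi (v : V) : lquot := \pi_lquot v.

Lemma lpiK : cancel (@repr V lquot) lpi.
Proof. exact: reprK. Qed.

Lemma lpiE u v : lpi u = lpi v <-> u - v \in linspan.
Proof.
rewrite /lpi -[_ \in _]/(Quotient.equiv linspan u v).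
by split=> [/eqP|h]; [rewrite piE | apply/eqP; rewrite piE].
Qed.

Lemma lpiD : {morph lpi : u v / u + v}.
Proof. by move=> u v; rewrite /lpi !piE. Qed.

Lemma lpi_repr v : repr (lpi v) - v \in linspan.
Proof. by apply/lpiE; rewrite lpiK. Qed.

Definition lquot_scale (a : K) (x : lquot) : lquot := lpi (a *: repr x).

Lemma lpiZ a v : lpi (a *: v) = lquot_scale a (lpi v).
Proof. by apply/esym/lpiE; rewrite -scalerBr rpredZ ?lpi_repr. Qed.

Fact lquot_scaleA a b x :
  lquot_scale a (lquot_scale b x) = lquot_scale (a * b) x.
Proof. by rewrite -[x]lpiK -!lpiZ scalerA. Qed.

Fact lquot_scale1 : left_id 1 lquot_scale.
Proof. by move=> x; rewrite -[x]lpiK -!lpiZ scale1r. Qed.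

Fact lquot_scaleDr : right_distributive lquot_scale +%R.
Proof.
by move=> a x y; rewrite -[x]lpiK -[y]lpiK -lpiD -!lpiZ scalerDr lpiD.
Qed.

Fact lquot_scaleDl x : {morph lquot_scale^~ x : a b / a + b}.
Proof. by move=> a b; rewrite -[x]lpiK -!lpiZ scalerDl lpiD. Qed.

HB.instance Definition _ := GRing.Zmodule_isLmodule.Build K lquot
  lquot_scaleA lquot_scale1 lquot_scaleDr lquot_scaleDl.

Fact lpi_linear : linear lpi.
Proof. by move=> a u v; rewrite lpiD; congr (_ + _); exact: lpiZ. Qed.

HB.instance Definition _ := GRing.isLinear.Build K V lquot *:%R lpi lpi_linear.

End LinearSpan.

Lemma linspan_map (K : fieldType) (V V' : lmodType K) (f : {linear V -> V'})
    (S : set V) (S' : set V') :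
  (forall s, S s -> f s \in linspan S') ->
  forall v, v \in linspan S -> f v \in linspan S'.
Proof.
move=> fS v /linspanP Sv.
pose P : {pred V} := [pred v | f v \in linspan S'].
have Pclosed : submod_closed P.
  split=> [|a x y Px Py]; rewrite -[_ \in P]/(f _ \in linspan S').
    by rewrite linear0 rpred0.
  by rewrite linearP rpredD ?rpredZ.
pose W : submodClosed V := HB.pack_for (submodClosed V) P
  (GRing.isSubmodClosed.Build K V P Pclosed).
exact: (Sv W fS).
Qed.

Section FreeAlgebra.
Variables (K : fieldType) (X : choiceType).

Definition free_alg := {malg K[{fmonom X}]}.

HB.instance Definition _ := GRing.Lalgebra.on free_alg.

Definition free_gen (x : X) : free_alg := << fmu x >>.

Fact free_scalerAr (a : K) (u v : free_alg) : u * (a *: v) = a *: (u * v).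
Proof.
suff aC : u * a%:MP = a%:MP * u by rewrite -!mul_malgC !mulrA aC.
rewrite mul_malgC (malgM_def u) fgmulgU malgZ_def /fgscale.
by apply: eq_bigr => k _; rewrite mulm1 mulrC.
Qed.

Definition free_mull (u v : free_alg) : free_alg := u * v.
Definition free_mulr (u v : free_alg) : free_alg := v * u.

Fact free_mull_linear u : linear (free_mull u).
Proof. by move=> a v w; rewrite /free_mull mulrDr free_scalerAr. Qed.

Fact free_mulr_linear u : linear (free_mulr u).
Proof. by move=> a v w; rewrite /free_mulr mulrDl scalerAl. Qed.

HB.instance Definition _ u := GRing.isLinear.Build K free_alg free_alg *:%R
  (free_mull u) (free_mull_linear u).
HB.instance Definition _ u := GRing.isLinear.Build K free_alg free_alg *:%R
  (free_mulr u) (free_mulr_linear u).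

End FreeAlgebra.

Section Enveloping.
Variables (K : fieldType) (g : lmodType K) (br : g -> g -> g).

Local Notation F := (free_alg K g).
Local Notation iota := (@free_gen K g).

(* F is the free algebra on the underlying set of g, so the relations that
   make iota linear (and thus turn F into the tensor algebra of g) are
   imposed together with those that turn brackets into commutators. *)
Inductive env_rel : set F :=
| EnvLinear a x y : env_rel (iota (a *: x + y) - (a *: iota x + iota y))
| EnvBracket x y : env_rel (iota x * iota y - iota y * iota x - iota (br x y)).

Definition env_ideal : set F :=
  [set w | exists u r v, env_rel r /\ w = u * r * v].

Definition env := lquot env_ideal.

HB.instance Definition _ := GRing.Lmodule.on env.

Local Notation pi := (lpi env_ideal).

Definition env_one : env := pi 1.
Definition env_mul (x y : env) : env := pi (repr x * repr y).

Lemma env_mulE u v : pi (u * v) = env_mul (pi u) (pi v).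
Proof.
have idl w c : c \in linspan env_ideal -> w * c \in linspan env_ideal.
  apply: (linspan_map (f := free_mull w)) => s [u0 [r [v0 [hr ->]]]].
  by apply: mem_linspan; exists (w * u0), r, v0; rewrite /= /free_mull !mulrA.
have idr w c : c \in linspan env_ideal -> c * w \in linspan env_ideal.
  apply: (linspan_map (f := free_mulr w)) => s [u0 [r [v0 [hr ->]]]].
  by apply: mem_linspan; exists u0, r, (v0 * w); rewrite /= /free_mulr !mulrA.
apply/esym/lpiE.
set u' := repr _; set v' := repr _.
have -> : u' * v' - u * v = (u' - u) * v' + u * (v' - v).
  by rewrite mulrBl mulrBr addrA subrK.
by apply: rpredD; [apply: idr | apply: idl]; apply: lpi_repr.
Qed.

Fact env_mulA : associative env_mul.
Proof.
by move=> x y z; rewrite -[x]lpiK -[y]lpiK -[z]lpiK -!env_mulE mulrA.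
Qed.

Fact env_mul1 : left_id env_one env_mul.
Proof. by move=> x; rewrite -[x]lpiK -env_mulE mul1r. Qed.

Fact env_mulr1 : right_id env_one env_mul.
Proof. by move=> x; rewrite -[x]lpiK -env_mulE mulr1. Qed.

Fact env_mulDl : left_distributive env_mul +%R.
Proof.
move=> x y z; rewrite -[x]lpiK -[y]lpiK -[z]lpiK -lpiD -!env_mulE mulrDl.
exact: lpiD.
Qed.

Fact env_mulDr : right_distributive env_mul +%R.
Proof.
move=> x y z; rewrite -[x]lpiK -[y]lpiK -[z]lpiK -lpiD -!env_mulE mulrDr.
exact: lpiD.
Qed.

HB.instance Definition _ := GRing.Zmodule_isPzRing.Build env
  env_mulA env_mul1 env_mulr1 env_mulDl env_mulDr.

Definition env_gen (x : g) : env := pi (iota x).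

Lemma env_gen_linear : linear env_gen.
Proof.
move=> a x y; rewrite /env_gen -linearP; apply/lpiE/mem_linspan.
by exists 1, (iota (a *: x + y) - (a *: iota x + iota y)), 1;
  split; [exact: EnvLinear | rewrite mul1r mulr1].
Qed.

Lemma env_gen_bracket x y :
  env_gen (br x y) = env_gen x * env_gen y - env_gen y * env_gen x.
Proof.
transitivity (pi (iota x * iota y - iota y * iota x)).
  apply/esym/lpiE/mem_linspan.
  by exists 1, (iota x * iota y - iota y * iota x - iota (br x y)), 1;
    split; [exact: EnvBracket | rewrite mul1r mulr1].
by rewrite linearB; congr (_ - _); exact: env_mulE.
Qed.

Lemma env_scalerAr (a : K) (u v : env) : u * (a *: v) = a *: (u * v).
Proof.
rewrite -[u]lpiK -[v]lpiK -linearZ /=.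
rewrite -[LHS]env_mulE -[_ * _ in RHS]env_mulE -linearZ.
by rewrite free_scalerAr.
Qed.

(* For a subalgebra b of g and a character chi of b, this is the induced
   module U(g) (x)_{U(b)} K_chi, i.e. the quotient of U(g) by the left ideal
   generated by the elements x - chi x, with x in b. *)
Section Induced.
Variables (b : set g) (chi : g -> K).

Definition ind_ideal : set env :=
  [set w | exists u x, b x /\ w = u * (env_gen x - chi x *: (1 : env))].

Definition ind := lquot ind_ideal.

HB.instance Definition _ := GRing.Lmodule.on ind.

Definition ind_vac : ind := lpi ind_ideal 1.

Definition ind_act (x : g) (w : ind) : ind :=
  lpi ind_ideal (env_gen x * repr w).

Lemma ind_actE x u :
  ind_act x (lpi ind_ideal u) = lpi ind_ideal (env_gen x * u).
Proof.
apply/lpiE; rewrite -mulrBr; have := lpi_repr ind_ideal u; move: (repr _ - u).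
pose f (v : env) : env := env_gen x * v.
have f_lin : linear f by move=> a v w; rewrite /f mulrDr env_scalerAr.
pose fl := HB.pack_for {linear env -> env} f
  (GRing.isLinear.Build K env env *:%R f f_lin).
apply: (linspan_map (f := fl)) => s [v [y [hy ->]]].
by apply: mem_linspan; exists (env_gen x * v), y; rewrite /= /f mulrA.
Qed.

Lemma ind_act_vac x : b x -> ind_act x ind_vac = chi x *: ind_vac.
Proof.
move=> bx; rewrite ind_actE -linearZ; apply/lpiE/mem_linspan.
by exists 1, x; rewrite mulr1 mul1r.
Qed.

End Induced.
End Enveloping.

Section TwistedAffine.
Variables (K : fieldType) (h : vectType K) (form : h -> h -> K).
Variables (nu : 'End(h)) (omega : K) (p : nat).

Definition eig (r : int) : {vspace h} := passmx.leigenspace nu (omega ^ r).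

Definition eig_proj (r : int) : 'End(h) :=
  daddv_pi (eig r) (\sum_(s < p | s%:Z != r %[mod p]%Z) eig s)%VS.

(* An exponent n in (1/p)Z is encoded throughout by the integer N = p n: the
   element \sum_N f N (x) t^(N/p) is represented by the function f. *)
Definition loop_pred : {pred int -> h} :=
  [pred f | `[< finite_set [set N | f N != 0] /\ forall N, f N \in eig N >]].

Fact loop_submod : submod_closed loop_pred.
Proof.
have loopP f : reflect (finite_set [set N | f N != 0] /\
    forall N, f N \in eig N) (f \in loop_pred) by exact: asboolP.
split=> [|a f1 f2 /loopP[fin1 gr1] /loopP[fin2 gr2]]; apply/loopP; split.
- by apply: (sub_finite_set _ (finite_set0 int)) => N /=; rewrite eqxx.
- by move=> N; exact: mem0v.
- have: finite_set ([set N | f1 N != 0] `|` [set N | f2 N != 0]).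
    by rewrite finite_setU.
  apply: sub_finite_set => N /=; apply: contra_neqP => /not_orP.
  by case=> /negP/negPn/eqP f1N /negP/negPn/eqP f2N;
    rewrite -[LHS]/(a *: f1 N + f2 N) f1N f2N scaler0 addr0.
- by move=> N; rewrite -[_ N]/(a *: f1 N + f2 N) memvD ?memvZ.
Qed.

HB.instance Definition _ := GRing.isSubmodClosed.Build K (int -> h) loop_pred
  loop_submod.

Record loop := Loop { loop_fun :> int -> h; _ : loop_fun \in loop_pred }.

HB.instance Definition _ := [isSub for loop_fun].
HB.instance Definition _ := [Choice of loop by <:].
HB.instance Definition _ := [SubChoice_isSubLmodule of loop by <:].

Fact loop_mono_subproof (alpha : h) (N : int) :
  (fun M => if M == N then eig_proj N alpha else 0) \in loop_pred.
Proof.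
apply/asboolP; split=> [|M]; last by case: eqP => [->|_]; rewrite ?memv_pi ?mem0v.
apply: (sub_finite_set _ (finite_set1 N)) => M /=.
by case: (eqVneq M N) => [-> //|_]; rewrite eqxx.
Qed.

Definition loop_mono (alpha : h) (N : int) : loop :=
  Loop (loop_mono_subproof alpha N).

(* The second component is the coefficient of the central element C. *)
Definition affine := (loop * K^o)%type.

HB.instance Definition _ := GRing.Lmodule.on affine.

Definition affine_br (u v : affine) : affine :=
  (0, \sum_(N \in [set: int]) form (u.1 N) (v.1 (- N)) * (N%:~R / p%:R)).

Definition affine_nneg : set affine := [set u : affine | forall N : int, N < 0 -> u.1 N = 0].

Definition affine_char (u : affine) : K := u.2.

Definition fock := ind affine_br affine_nneg affine_char.

HB.instance Definition _ := GRing.Lmodule.on fock.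

Definition mode (alpha : h) (N : int) : fock -> fock :=
  @ind_act _ _ affine_br affine_nneg affine_char (loop_mono alpha N, 0).

Definition normal_prod (alpha : h) (M : int) (beta : h) (N : int) : fock -> fock :=
  if 0 < M then mode beta N \o mode alpha M else mode alpha M \o mode beta N.

Definition rational_lattice (L : set h) : Prop :=
  (exists n (b : n.-tuple h),
     [/\ forall x, L x <-> exists c : 'I_n -> int, x = \sum_i tnth b i *~ c i,
         forall c : 'I_n -> int,
           \sum_i tnth b i *~ c i = 0 -> forall i, c i = 0
       & <<b>>%VS = fullv]) /\
  (forall x y, L x -> L y -> exists q : rat, form x y = ratr q).

End TwistedAffine.

Section FormalSeries.
Variable K : fieldType.

(* A formal series is the function giving its coefficients. The sums below (and
   later) over a whole infinite type are library sums, which are 0 when the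
   support is infinite; in all uses the support is finite. *)
Definition ser_scale (E : zmodType) (A : lmodType K) (f : E -> K) (F : E -> A) :
  E -> A := fun e => \sum_(u \in [set: E]) f u *: F (e - u).

Definition ser_comp (E : zmodType) (V : lmodType K) (F G : E -> V -> V) :
  E -> V -> V := fun e => \sum_(u \in [set: E]) (F u \o G (e - u)).

Definition ser_comm (E : zmodType) (V : lmodType K) (F G : E -> V -> V) :=
  ser_comp F G - ser_comp G F.

Fixpoint ps_inv_seq (f : nat -> K) (n : nat) : seq K :=
  if n is m.+1 then
    let s := ps_inv_seq f m in
    rcons s (((m == 0)%:R - \sum_(j < m) f (m - j)%N * s`_j) / f 0%N)
  else [::].

Definition ps_inv (f : nat -> K) (n : nat) : K := (ps_inv_seq f n.+1)`_n.

Lemma size_ps_inv_seq f n : size (ps_inv_seq f n) = n.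
Proof. by elim: n => //= n IHn; rewrite size_rcons IHn. Qed.

Lemma nth_ps_inv_seq f n j : (j < n)%N -> (ps_inv_seq f n)`_j = ps_inv f j.
Proof.
elim: n => // n IHn; rewrite ltnS leq_eqVlt => /predU1P[-> //|ltjn].
by rewrite /= nth_rcons size_ps_inv_seq ltjn IHn.
Qed.

Lemma ps_invP f n : f 0%N != 0 ->
  \sum_(j < n.+1) f (n - j)%N * ps_inv f j = (n == 0)%:R.
Proof.
move=> f0; rewrite big_ord_recr /= subnn {2}/ps_inv /= nth_rcons.
rewrite size_ps_inv_seq ltnn eqxx mulrC divfK //.
under [X in _ - X]eq_bigr => j _ do rewrite nth_ps_inv_seq //.
by rewrite addrC subrK.
Qed.

Definition exp_z (c : K) (m : int) : K^o :=
  if 0 <= m then c ^+ absz m / ((absz m)`!)%:R else 0.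

(* 1 / (1 - e^(-z)) = z^-1 * ((1 - e^(-z)) / z)^-1 *)
Definition inv_one_sub_exp (m : int) : K^o :=
  if -1 <= m then
    ps_inv (fun n => (-1) ^+ n / (n.+1`!)%:R) (absz (m + 1))
  else 0.

Definition deriv_z (f : int -> K) (m : int) : K := (m + 1)%:~R * f (m + 1).

(* Series in n variables y_i, with coefficients indexed by 'rV[int]_n; a row
   vector l : 'rV[K]_n stands for the linear form \sum_i l 0 i * y_i. *)
Section Multivariate.
Variable n : nat.
Implicit Types (l : 'rV[K]_n) (e : 'rV[int]_n) (i : 'I_n).

Definition exp_lin l e : K :=
  if [forall i, 0 <= e 0 i] then
    \prod_i (l 0 i ^+ absz (e 0 i) / ((absz (e 0 i))`!)%:R)
  else 0.

(* Binomial expansion of l^k in nonnegative powers of the y_i, i != i0, for a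
   linear form l in which y_i0 occurs:
     \sum_J k (k - 1) ... (k - J + 1) / J! * (l_i0 y_i0)^(k - J) * l'^J,
   where l' = l - l_i0 y_i0 and J is the total degree in the y_i, i != i0. *)
Definition lin_pow i0 l (k : int) e : K :=
  if (\sum_i e 0 i == k) && [forall i, (i != i0) ==> (0 <= e 0 i)] then
    (\prod_(j < absz (k - e 0 i0)%R) (k%:~R - j%:R)) * l 0 i0 ^ e 0 i0 *
    \prod_(i | i != i0) (l 0 i ^+ absz (e 0 i) / ((absz (e 0 i))`!)%:R)
  else 0.

Definition laurent_at i0 l (f : int -> K) e : K :=
  \sum_(k \in [set: int]) f k * lin_pow i0 l k e.

Definition deriv_y (A : lmodType K) i (F : 'rV[int]_n -> A) e : A :=
  (e 0 i + 1)%:~R *: F (e + delta_mx 0 i).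

Lemma laurent_atE i0 l f e :
  laurent_at i0 l f e = f (\sum_i e 0 i) * lin_pow i0 l (\sum_i e 0 i) e.
Proof.
rewrite /laurent_at -(fsbig_widen [set \sum_i e 0 i]) ?fsbig_set1 // => k [_ /=].
by move=> /eqP; rewrite eq_sym /lin_pow => /negPf ->; rewrite mulr0.
Qed.

Lemma lin_powS i0 i l e (k := \sum_j e 0 j) : [pchar K] =i pred0 ->
  l 0 i0 != 0 ->
  (e 0 i + 1)%:~R * lin_pow i0 l (k + 1) (e + delta_mx 0 i) =
  l 0 i * (k + 1)%:~R * lin_pow i0 l k e.
Proof.
move=> K0 l0.
have ffS J : \prod_(j < J.+1) ((k + 1)%:~R - j%:R) =
    (k + 1)%:~R * \prod_(j < J) (k%:~R - j%:R) :> K.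
  rewrite big_ord_recl subr0; congr (_ * _); apply: eq_bigr => j _.
  by rewrite lift0 -natr1 intrD mulr1z opprD addrACA subrr addr0.
have eE j : (e + delta_mx 0 i) 0 j = e 0 j + (j == i)%:R by rewrite !mxE.
have sumE : \sum_j (e + delta_mx 0 i) 0 j = k + 1.
  under eq_bigr do rewrite eE.
  rewrite big_split /=; congr (_ + _); rewrite (bigD1 i) //= eqxx big1 ?addr0 //.
  by move=> j /negPf ->.
rewrite /lin_pow sumE !eqxx /=.
have kE : k - e 0 i0 = \sum_(j | j != i0) e 0 j.
  by rewrite /k (bigD1 i0) //= addrAC subrr add0r.
have [ii0|nii0] := eqVneq i i0.
  subst i; under eq_forallb => j.
    rewrite eE; have -> : (j != i0) ==> (0 <= e 0 j + (j == i0)%:R) =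
      ((j != i0) ==> (0 <= e 0 j)) by case: eqP => //= _; rewrite addr0.
    over.
  case: ifP => [/forallP e_ge0|_]; last by rewrite !mulr0.
  rewrite !eE eqxx /=.
  have -> : k + 1 - (e 0 i0 + 1) = k - e 0 i0 by ring.
  have J_ge0 : 0 <= k - e 0 i0.
    by rewrite kE sumr_ge0 // => j jn; exact: (implyP (e_ge0 j)).
  set J := absz _.
  have eJ : e 0 i0 + 1 = k + 1 - J%:Z by rewrite /J gez0_abs //; ring.
  have := ffS J; rewrite big_ord_recr /= => ffJ.
  have -> : \prod_(j < n | j != i0) (l 0 j ^+ absz ((e + delta_mx 0 i0) 0 j) /
      ((absz ((e + delta_mx 0 i0) 0 j))`!)%:R) =
      \prod_(j < n | j != i0) (l 0 j ^+ absz (e 0 j) / ((absz (e 0 j))`!)%:R).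
    by apply: eq_bigr => j /negPf jn; rewrite eE jn addr0.
  rewrite expfzDr // expr1z.
  have eJR : (e 0 i0 + 1)%:~R = (k + 1)%:~R - J%:R :> K by rewrite eJ intrB.
  rewrite eJR !mulrA [_ * \prod_(_ < J) _]mulrC ffJ; ring.
have forallE : [forall j, (j != i0) ==> (0 <= (e + delta_mx 0 i) 0 j)] =
    (-1 <= e 0 i) && [forall j, (j != i0) && (j != i) ==> (0 <= e 0 j)].
  apply/forallP/andP => [H|[H1 /forallP H] j].
    split; first by have := H i; rewrite nii0 eE eqxx -lerBlDr sub0r.
    apply/forallP => j; apply/implyP => /andP[ji0 ji].
    by have := H j; rewrite ji0 eE (negPf ji) addr0.
  apply/implyP => ji0; rewrite eE; have [->|ji] := eqVneq j i.
    by rewrite -lerBlDr sub0r.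
  by have := H j; rewrite ji0 ji addr0.
have forallE' : [forall j, (j != i0) ==> (0 <= e 0 j)] =
    (0 <= e 0 i) && [forall j, (j != i0) && (j != i) ==> (0 <= e 0 j)].
  apply/forallP/andP => [H|[H1 /forallP H] j].
    split; first by have := H i; rewrite nii0.
    apply/forallP => j; apply/implyP => /andP[ji0 ji].
    by have := H j; rewrite ji0.
  by apply/implyP => ji0; have [->//|ji] := eqVneq j i; have := H j; rewrite ji0 ji.
rewrite forallE forallE'.
have [e_ge0|e_lt0] := leP 0 (e 0 i); last first.
  rewrite andFb mulr0; have [->|en1] := eqVneq (e 0 i) (-1).
    by rewrite addNr mul0r.
  suff -> : (-1 <= e 0 i) = false by rewrite mulr0.
  by apply/negP => e_ge; move: en1 e_lt0 e_ge; lia.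
have -> /= : -1 <= e 0 i by apply: le_trans e_ge0.
case: ifP => [/forallP e_ge|_]; last by rewrite !mulr0.
rewrite eE eq_sym (negPf nii0) addr0.
have J_ge0 : 0 <= k - e 0 i0.
  rewrite kE sumr_ge0 // => j ji0; have [->//|ji] := eqVneq j i.
  by have := e_ge j; rewrite ji0 ji.
have -> : absz (k + 1 - e 0 i0)%R = (absz (k - e 0 i0)%R).+1.
  by move: J_ge0; lia.
rewrite ffS (bigD1 i) //= [in RHS](bigD1 i) //= eE eqxx.
have -> : \prod_(j < n | (j != i0) && (j != i))
    (l 0 j ^+ absz ((e + delta_mx 0 i) 0 j) /
      ((absz ((e + delta_mx 0 i) 0 j))`!)%:R) =
    \prod_(j < n | (j != i0) && (j != i))
      (l 0 j ^+ absz (e 0 j) / ((absz (e 0 j))`!)%:R).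
  by apply: eq_bigr => j /andP[_ /negPf jn]; rewrite eE jn addr0.
have -> : absz (e 0 i + true)%R = (absz (e 0 i)).+1 by move: e_ge0; lia.
rewrite factS natrM exprS.
set m := absz (e 0 i).
have -> : (e 0 i + 1)%:~R = m.+1%:R :> K.
  by rewrite -[e 0 i]gez0_abs // -/m -natr1 intrD.
have m0 : m.+1%:R != 0 :> K by rewrite ((pcharf0P K).1 K0).
rewrite invfM; set rhs := RHS.
by transitivity (m.+1%:R / m.+1%:R * rhs); 
  [rewrite /rhs; ring | rewrite divff ?mul1r].
Qed.

Lemma deriv_y_laurent_at i0 i l f e : [pchar K] =i pred0 -> l 0 i0 != 0 ->
  deriv_y i (laurent_at i0 l f : _ -> K^o) e =
  l 0 i * laurent_at i0 l (deriv_z f) e.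
Proof.
move=> K0 l0; rewrite /deriv_y !laurent_atE /deriv_z.
have -> : \sum_j (e + delta_mx 0 i) 0 j = \sum_j e 0 j + 1.
  under eq_bigr do rewrite mxE.
  rewrite big_split /=; congr (_ + _).
  rewrite (bigD1 i) //= mxE !eqxx big1 ?addr0 // => j /negPf ji.
  by rewrite mxE ji.
rewrite -[LHS]/(_ * _) mulrCA lin_powS //; ring.
Qed.

End Multivariate.
End FormalSeries.

Arguments laurent_at {K n}.


Section Virasoro.
Variables (K : fieldType) (h : vectType K) (form : h -> h -> K).
Variables (nu : 'End(h)) (omega : K) (p d : nat) (alpha : d.-tuple h).

Local Notation S := (fock form nu omega p).

(* (X, e) is the index of x_1^(X_1/p) x_2^(X_2/p) y_1^(e_1) ... y_4^(e_4). *)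
Definition expo := ('rV[int]_2 * 'rV[int]_4)%type.

HB.instance Definition _ := GRing.Zmodule.on expo.

(* Coefficient of x^(N/p) y^e in 1/2 \sum_q :alpha_q<e^a x> alpha_q<e^b x>:,
   where alpha<e^a x> = \sum_M alpha(M/p) e^(- M a / p) x^(-M/p). The sum over M
   has finite support once applied to a vector. *)
Definition Lquad (a b : 'rV[K]_4) (N : int) (e : 'rV[int]_4) : S -> S :=
  fun v => 2^-1 *: \sum_(M \in [set: int])
    exp_lin (- (M%:~R / p%:R) *: a - ((- N - M)%:~R / p%:R) *: b) e *:
    \sum_(q < d)
      normal_prod (tnth alpha q) M (tnth alpha q) (- N - M) v.

(* \sum_k e^(- k z / p) dim h_(k) / (1 - e^(- z)) as a Laurent series in z; the
   function differentiated in the definition of L^(y_1, y_2) is its value at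
   z = y_1 - y_2, so that its y_1-derivative is the value at z = y_1 - y_2 of the
   z-derivative (see deriv_y_laurent_at). *)
Definition dim_series : int -> K^o :=
  \sum_(k < p) (\dim (eig nu omega k))%:R *:
    ser_scale (exp_z (- (k%:R / p%:R))) (@inv_one_sub_exp K).

(* L^(a, b)<x_j>, for linear forms a and b, negative powers of a - b being
   expanded in nonnegative powers of the variables other than y_i0. *)
Definition Lbar (j : 'I_2) (i0 : 'I_4) (a b : 'rV[K]_4) : expo -> S -> S :=
  fun Xe =>
    (if Xe.1 == Xe.1 0 j *: delta_mx 0 j then Lquad a b (Xe.1 0 j) Xe.2 else 0)
    - (if Xe.1 == 0 then
         (2^-1 * laurent_at i0 (a - b) (deriv_z dim_series) Xe.2) *: id
       else 0).

(* delta(e^a x_1 / (e^b x_2)) = \sum_n e^(n (a - b)) x_1^n x_2^(-n) *)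
Definition delta_ser (a b : 'rV[K]_4) : expo -> K :=
  fun Xe => \sum_(n \in [set: int])
    if Xe.1 == (n * p%:Z) *: (delta_mx 0 0 - delta_mx 0 1) then
      exp_lin (n%:~R *: (a - b)) Xe.2
    else 0.

Definition pderiv_y (i : 'I_4) (F : expo -> S -> S) : expo -> S -> S :=
  fun Xe => deriv_y i (fun e => F (Xe.1, e)) Xe.2.

End Virasoro.

Arguments Lbar {K h} form nu omega p {d} alpha j i0 a b.

(* Main.v *)
From HB Require Import structures.
Require Import Defs.
From mathcomp Require Import all_boot all_order all_algebra.
From mathcomp Require Import boolp classical_sets functions cardinality fsbigop.
From mathcomp Require Import reals complex.
From mathcomp Require Import zify ring.
From mathcomp.multinomials Require Import monalg.

Set Implicit Arguments.
Unset Strict Implicit.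
Unset Printing Implicit Defensive.

Import Order.TTheory GRing.Theory Num.Theory.

Local Open Scope classical_set_scope.
Local Open Scope ring_scope.

(** The formula holds on every module over the twisted Heisenberg algebra on
    which positive modes act locally nilpotently. The Fock space enters only
    through [fock_heisenberg]: its modes satisfy the commutation relations
    [mode_comm], the mode of index [M] depends only on the component of degree [M]
    modulo [p] ([mode_proj]), each vector is annihilated by the modes of large
    index ([mode_nilpotent]), and the trace of the projection on an eigenspace is
    its dimension ([sum_form_eig_proj]).

    A coefficient of [L^(y_1, y_2)<x>] is a scalar plus a quadratic
    [1/2 \sum_M c M \sum_q :alpha_q(M) alpha_q(- N - M):], where [c M] is a
    coefficient of an exponential in [y_1, y_2]. The commutator of a mode with a
    quadratic is a multiple of a mode ([a_wquad]), and it vanishes unless [p]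
    divides [N]; this divisibility becomes the delta series. Hence the commutator
    of two quadratics is a sum over [M] of products of two modes. Rewriting these
    as normal ordered products gives a quadratic plus a scalar, the anomaly
    ([wquad_comm]). Multiplying the weight by the index of a mode amounts to
    differentiating the exponential in [y_1] or [y_2], and the quadratic is thus
    the quadratic part of the right-hand side.

    It remains to compare scalars ([scalar_terms]). Let
    [f z = \sum_k dim h_(k) e^(- k z / p) / (1 - e^(- z))], which is formally
    [\sum_(M >= 0) dim h_(M) e^(- M z / p)]. For an integer [k] the series
    [e^(k z) f - f] is therefore a finite sum of exponentials
    ([texp_dimser_int]), and [f'] is even because the eigenspaces of degrees [M]
    and [- M] have the same dimension ([deriv_dimser_even]). In the variables
    [y_1, ..., y_4] both sides of the scalar identity solve the same first order
    equations, which express the derivatives in [y_2, y_3, y_4] through the one in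
    [y_1]; such series are determined by their restriction to the [y_1]-axis
    ([transported_eq0]), and there the identity follows from the finite sum for
    [e^(k z) f - f] ([dimser_anomaly]). In the lemmas below these variables are
    numbered from [0]. *)

(** * Finitely supported sums *)

Section FiniteSums.
Variable I : choiceType.

(** [fin_supp f]: the function [f] vanishes outside a finite list. *)
Definition fin_supp (A : nmodType) (f : I -> A) :=
  exists r : seq I, forall x, x \notin r -> f x = 0.

(** A sum over a whole type is the sum over any list containing the support. *)
Lemma fsum_seq (A : nmodType) (r : seq I) (f : I -> A) : uniq r ->
  (forall x, x \notin r -> f x = 0) ->
  \sum_(x \in [set: I]) f x = \sum_(x <- r) f x.
Proof.
move=> ur f0; rewrite (fsbigE r) //; last by move=> i _; exact: f0.
by apply: eq_bigl => i; rewrite in_setT.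
Qed.

Lemma fin_supp_uniq (A : nmodType) (f : I -> A) : fin_supp f ->
  exists2 r : seq I, uniq r & forall x, x \notin r -> f x = 0.
Proof.
move=> [r fr]; exists (undup r); first exact: undup_uniq.
by move=> x; rewrite mem_undup; exact: fr.
Qed.

Lemma fin_suppW (A B : nmodType) (f : I -> A) (g : I -> B) :
  (forall x, f x = 0 -> g x = 0) -> fin_supp f -> fin_supp g.
Proof. by move=> fg [r fr]; exists r => x /fr/fg. Qed.

Lemma fin_suppD (A : nmodType) (f g : I -> A) :
  fin_supp f -> fin_supp g -> fin_supp (fun x => f x + g x).
Proof.
move=> [r fr] [s gs]; exists (r ++ s) => x.
by rewrite mem_cat negb_or => /andP[/fr-> /gs->]; rewrite addr0.
Qed.

Lemma fsumD (A : nmodType) (f g : I -> A) : fin_supp f -> fin_supp g ->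
  \sum_(x \in [set: I]) (f x + g x) =
  \sum_(x \in [set: I]) f x + \sum_(x \in [set: I]) g x.
Proof.
move=> [r fr] [s gs]; pose t := undup (r ++ s).
have tE x : x \notin t -> f x = 0 /\ g x = 0.
  by rewrite mem_undup mem_cat negb_or => /andP[/fr-> /gs->].
have ut : uniq t by exact: undup_uniq.
rewrite !(fsum_seq ut) ?big_split //.
- by move=> x /tE[].
- by move=> x /tE[].
- by move=> x /tE[-> ->]; rewrite addr0.
Qed.

Lemma eq_fsum (A : nmodType) (f g : I -> A) : f =1 g ->
  \sum_(x \in [set: I]) f x = \sum_(x \in [set: I]) g x.
Proof. by move=> fg; apply: eq_fsbigr => x _. Qed.

Lemma fsum0 (A : nmodType) (f : I -> A) : (forall x, f x = 0) ->
  \sum_(x \in [set: I]) f x = 0.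
Proof. by move=> f0; apply: fsbig1. Qed.

Lemma fsum_morph (A B : nmodType) (L : A -> B) (f : I -> A) :
  L 0 = 0 -> {morph L : x y / x + y} -> fin_supp f ->
  L (\sum_(x \in [set: I]) f x) = \sum_(x \in [set: I]) L (f x).
Proof.
move=> L0 LD /fin_supp_uniq[r ur fr].
rewrite (fsum_seq ur fr) (@fsum_seq _ r) //; last by move=> x /fr ->.
by rewrite (big_morph L LD L0).
Qed.

Lemma fsumZ (K : nzRingType) (A : lmodType K) (c : K) (f : I -> A) :
  fin_supp f ->
  c *: \sum_(x \in [set: I]) f x = \sum_(x \in [set: I]) c *: f x.
Proof.
by apply: (fsum_morph (L := fun v => c *: v)); rewrite ?scaler0 // => x y;
  rewrite scalerDr.
Qed.

Lemma fsumN (A : zmodType) (f : I -> A) : fin_supp f ->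
  - \sum_(x \in [set: I]) f x = \sum_(x \in [set: I]) - f x.
Proof.
by apply: (fsum_morph (L := fun v => - v)); rewrite ?oppr0 // => x y;
  rewrite opprD.
Qed.

Lemma fsumB (A : zmodType) (f g : I -> A) : fin_supp f -> fin_supp g ->
  \sum_(x \in [set: I]) (f x - g x) =
  \sum_(x \in [set: I]) f x - \sum_(x \in [set: I]) g x.
Proof.
move=> hf hg; rewrite fsumN // fsumD //.
by apply: fin_suppW hg => x ->; rewrite oppr0.
Qed.

Lemma fsum1 (A : nmodType) (i : I) (f : I -> A) :
  (forall x, x != i -> f x = 0) -> \sum_(x \in [set: I]) f x = f i.
Proof.
move=> f0; rewrite (@fsum_seq _ [:: i]) ?big_seq1 // => x.
by rewrite inE => /f0.
Qed.

Lemma fsum_app (T : Type) (A : nmodType) (f : I -> T -> A) (v : T) :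
  fin_supp f ->
  (\sum_(x \in [set: I]) f x) v = \sum_(x \in [set: I]) f x v.
Proof. by apply: (fsum_morph (L := fun g : T -> A => g v)). Qed.

Lemma fsum_bigsum (A : nmodType) (J : Type) (s : seq J) (f : I -> J -> A) :
  (exists r : seq I, forall x, x \notin r -> forall j, f x j = 0) ->
  \sum_(x \in [set: I]) \sum_(j <- s) f x j =
  \sum_(j <- s) \sum_(x \in [set: I]) f x j.
Proof.
move=> [r0 fr0]; pose r := undup r0.
have ur : uniq r := undup_uniq _.
have fr x : x \notin r -> forall j, f x j = 0 by rewrite mem_undup => /fr0.
rewrite (@fsum_seq _ r) //; last by move=> x /fr f0; rewrite big1.
rewrite exchange_big /=; apply: eq_bigr => j _; rewrite (@fsum_seq _ r) //.
by move=> x /fr ->.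
Qed.

End FiniteSums.

Lemma fsum_exchange (A : nmodType) (I J : choiceType) (f : I -> J -> A)
    (r : seq I) (s : seq J) :
  (forall x y, x \notin r -> f x y = 0) ->
  (forall x y, y \notin s -> f x y = 0) ->
  \sum_(x \in [set: I]) \sum_(y \in [set: J]) f x y =
  \sum_(y \in [set: J]) \sum_(x \in [set: I]) f x y.
Proof.
move=> fr fs; have ur : uniq (undup r) := undup_uniq _.
have us : uniq (undup s) := undup_uniq _.
have fr' x : x \notin undup r -> forall y, f x y = 0.
  by rewrite mem_undup => xr y; exact: fr.
have fs' y : y \notin undup s -> forall x, f x y = 0.
  by rewrite mem_undup => ys x; exact: fs.
transitivity (\sum_(x \in [set: I]) \sum_(y <- undup s) f x y).
  by apply: eq_fsum => x; apply: fsum_seq => // y /fs'.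
rewrite fsum_bigsum; last by exists (undup r).
by rewrite (fsum_seq us) // => y /fs' f0; apply: fsum0.
Qed.

Lemma fsum_reindex (A : nmodType) (I J : choiceType) (h : I -> J) (g : J -> I)
    (f : J -> A) : cancel h g -> cancel g h ->
  \sum_(y \in [set: J]) f y = \sum_(x \in [set: I]) f (h x).
Proof. by move=> hK gK; apply: reindex_fsbigT; exists g. Qed.

Lemma fin_supp_int (A : nmodType) (B : nat) (f : int -> A) :
  (forall x, (B < `|x|)%N -> f x = 0) -> fin_supp f.
Proof.
move=> f0; exists [seq i%:Z - B%:Z | i <- iota 0 (B.*2.+1)] => x xB.
apply: f0; rewrite ltnNge; apply: contra xB => xB.
apply/mapP; exists (absz (x + B%:Z)%R); last by move: xB; lia.
by rewrite mem_iota; move: xB; lia.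
Qed.

Lemma fin_supp_can (A : nmodType) (I J : choiceType) (h : I -> J) (g : J -> I)
    (f : J -> A) : cancel h g -> fin_supp f -> fin_supp (fun x => f (h x)).
Proof.
move=> hK [r fr]; exists (map g r) => x xr; apply: fr.
by apply: contra xr => xr; apply/mapP; exists (h x).
Qed.

(** Consequences of linearity stated as an equation on a bare function. *)
Section BareLinear.
Variables (K : nzRingType) (A B : lmodType K) (f : A -> B).
Hypothesis f_lin : forall a u v, f (a *: u + v) = a *: f u + f v.

Lemma lin0 : f 0 = 0.
Proof. by have := f_lin (-1) 0 0; rewrite scaler0 addr0 scaleN1r addNr. Qed.

Lemma linZ a u : f (a *: u) = a *: f u.
Proof. by have := f_lin a u 0; rewrite lin0 !addr0. Qed.

Lemma linD u v : f (u + v) = f u + f v.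
Proof. by have := f_lin 1 u v; rewrite !scale1r. Qed.

Lemma linB u v : f (u - v) = f u - f v.
Proof. by rewrite addrC -scaleN1r f_lin scaleN1r addrC. Qed.

Lemma lin_sum (I : Type) (r : seq I) (Q : pred I) (F : I -> A) :
  f (\sum_(i <- r | Q i) F i) = \sum_(i <- r | Q i) f (F i).
Proof. exact: (big_morph f linD lin0). Qed.

Lemma lin_fsum (I : choiceType) (F : I -> A) : fin_supp F ->
  f (\sum_(i \in [set: I]) F i) = \sum_(i \in [set: I]) f (F i).
Proof. by apply: fsum_morph; [exact: lin0 | exact: linD]. Qed.

End BareLinear.

(** * The eigenspace projections *)

Section EigenProjections.
Variables (K : fieldType) (h : vectType K) (form : {symmetric h}).
Variables (nu : 'End(h)) (omega : K) (p : nat).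
Hypothesis p_neq0 : p%:R != 0 :> K.
Hypothesis omega_prim : p.-primitive_root omega.
Hypothesis nu_isom : isometry form form nu.
Hypothesis nu_period : forall x, iter p nu x = x.

Local Notation eig := (eig nu omega).
Local Notation P := (eig_proj nu omega p).

Let p_gt0 : (0 < p)%N. Proof. exact: prim_order_gt0 omega_prim. Qed.

Let omega_neq0 : omega != 0.
Proof.
apply/eqP => o0; have := prim_expr_order omega_prim.
by rewrite o0 expr0n eqn0Ngt p_gt0 /= => /eqP; rewrite eq_sym oner_eq0.
Qed.

Lemma memv_eig r v : (v \in eig r) = (nu v == omega ^ r *: v).
Proof.
by rewrite memv_ker add_lfunE opp_lfunE scale_lfunE id_lfunE subr_eq0.
Qed.

Lemma omega_mod r s : (r = s %[mod p])%Z -> omega ^ r = omega ^ s.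
Proof.
have omod r' : omega ^ r' = omega ^ (r' %% p)%Z.
  rewrite {1}(divz_eq r' p) expfzDr // [_ * p%:Z]mulrC -exprz_exp -exprnP.
  by rewrite prim_expr_order // exp1rz mul1r.
by move=> rs; rewrite omod rs -omod.
Qed.

Lemma omega_eq1 r : (omega ^ r == 1) = (p %| r)%Z.
Proof.
apply/eqP/idP => [|/dvdz_mod0P pr]; last by rewrite (omega_mod (s := 0)) ?mod0z.
rewrite (omega_mod (esym (modz_mod r p))) /dvdz.
have : 0 <= (r %% p)%Z by apply: modz_ge0; move: p_gt0; lia.
case E : (r %% p)%Z => [n|//] _; rewrite -exprnP => on1.
have pn : (p %| n)%N by rewrite (prim_order_dvd omega_prim) on1.
have np : (n < p)%N by have := @ltz_pmod r p; rewrite E; move: p_gt0; lia.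
have n0 : n = 0%N.
  by apply/eqP; apply: contraTT pn; rewrite -lt0n => n_gt0; rewrite gtnNdvd.
by apply/dvdz_mod0P; rewrite E n0.
Qed.

Lemma eig_mod r s : (r = s %[mod p])%Z -> eig r = eig s.
Proof. by move=> rs; rewrite /Defs.eig (omega_mod rs). Qed.

Lemma eig_proj_mod r s : (r = s %[mod p])%Z -> P r = P s.
Proof. by move=> rs; rewrite /eig_proj (eig_mod rs) rs. Qed.

(** The average of the [omega^(- r j) nu^j], the explicit form of the
    projection on the [omega^r]-eigenspace. *)
Definition eig_avg (r : int) (x : h) : h :=
  p%:R^-1 *: \sum_(j < p) omega ^ (- r * j%:Z) *: iter j nu x.

Lemma omega_geom r : \sum_(j < p) omega ^ (r * j%:Z) =
  if (p %| r)%Z then p%:R else 0.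
Proof.
have -> : \sum_(j < p) omega ^ (r * j%:Z) = \sum_(j < p) (omega ^ r) ^+ j.
  by apply: eq_bigr => j _; rewrite exprnP exprz_exp.
rewrite -omega_eq1; have [->|o1] := eqVneq (omega ^ r) 1.
  by under eq_bigr do rewrite expr1n; rewrite sumr_const card_ord.
have : (omega ^ r) ^+ p = 1.
  rewrite exprnP exprz_exp mulrC -exprz_exp -exprnP.
  by rewrite prim_expr_order // exp1rz.
move=> /(congr1 (fun z => z - 1)); rewrite subrr subrX1 => /eqP.
by rewrite mulf_eq0 subr_eq0 (negPf o1) => /eqP.
Qed.

Lemma eig_avg_mem r x : eig_avg r x \in eig r.
Proof.
rewrite memvZ // memv_eig; apply/eqP.
rewrite linear_sum scaler_sumr /=.
case: p p_gt0 (prim_expr_order omega_prim) nu_period => // n _ on1 per.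
(* applying nu shifts the iterates cyclically, as nu^p = 1 *)
rewrite big_ord_recr /= [RHS]big_ord_recl /= addrC; congr (_ + _).
  rewrite linearZ /= -[nu (iter n nu x)]/(iter n.+1 nu x) per mulr0 expr0z.
  rewrite scale1r; congr (_ *: _).
  transitivity (omega ^ (r + - r * n.+1%:Z)); first by congr (_ ^ _); lia.
  by rewrite expfzDr // mulrC [- r * _]mulrC -exprz_exp -exprnP on1 exp1rz mul1r.
apply: eq_bigr => i _; rewrite linearZ /= scalerA -expfzDr //.
by congr (_ ^ _ *: _); rewrite /bump /=; lia.
Qed.

Lemma iter_eig r x j : x \in eig r -> iter j nu x = omega ^ (r * j%:Z) *: x.
Proof.
rewrite memv_eig => /eqP xr; elim: j => [|j IHj] /=.
  by rewrite mulr0 expr0z scale1r.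
rewrite IHj linearZ /= xr scalerA -expfzDr //.
by congr (_ ^ _ *: _); lia.
Qed.

Lemma eig_avg_eig r s x : x \in eig s ->
  eig_avg r x = if (p %| s - r)%Z then x else 0.
Proof.
move=> xs; rewrite /eig_avg.
have -> : \sum_(j < p) omega ^ (- r * j%:Z) *: iter j nu x =
    (\sum_(j < p) omega ^ ((s - r) * j%:Z)) *: x.
  rewrite scaler_suml; apply: eq_bigr => j _.
  rewrite (iter_eig _ xs) scalerA -expfzDr //.
  by congr (_ ^ _ *: _); lia.
rewrite omega_geom; case: ifP => _; last by rewrite scale0r scaler0.
by rewrite scalerA mulVf ?scale1r.
Qed.

(** The averages add up to the identity: [nu] is diagonalizable. *)
Lemma sum_eig_avg x : \sum_(r < p) eig_avg r x = x.
Proof.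
rewrite -scaler_sumr exchange_big /=.
have -> : \sum_(j < p) \sum_(i < p) omega ^ (- i%:Z * j%:Z) *: iter j nu x =
    \sum_(j < p) (if (p %| j)%N then p%:R else 0) *: iter j nu x.
  apply: eq_bigr => j _; rewrite -scaler_suml; congr (_ *: _).
  transitivity (\sum_(i < p) omega ^ (- j%:Z * i%:Z)).
    by apply: eq_bigr => i _; congr (_ ^ _); lia.
  by rewrite omega_geom dvdzE abszN.
case: p p_gt0 p_neq0 => // n _ n0.
rewrite big_ord_recl [(_ %| _)%N]dvdn0 big1 => [|j _].
  by rewrite addr0 scalerA mulVf ?scale1r.
by rewrite gtnNdvd ?scale0r //; have := ltn_ord j; rewrite /= /bump /=; lia.
Qed.

Lemma eig_projE r x : P r x = eig_avg r x.
Proof.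
pose U := eig r; pose W := (\sum_(s < p | s%:Z != r %[mod p]%Z) eig s)%VS.
have eig_avg_linear : linear (eig_avg r).
  move=> a u v; rewrite /eig_avg scalerA mulrC -scalerA -scalerDr.
  congr (_ *: _); rewrite scaler_sumr -big_split /=; apply: eq_bigr => j _.
  have -> : iter j nu (a *: u + v) = a *: iter j nu u + iter j nu v.
    by elim: (val j) => //= i ->; rewrite linearP.
  by rewrite scalerDr !scalerA mulrC.
pose avg := HB.pack_for {linear h -> h} (eig_avg r)
  (GRing.isLinear.Build K h h *:%R (eig_avg r) eig_avg_linear).
have W0 w : w \in W -> eig_avg r w = 0.
  case/memv_sumP => ws wsE ->.
  rewrite -[LHS]/(avg _) linear_sum big1 //= => s sr.
  rewrite (eig_avg_eig _ (wsE s sr)); case: ifP => // /dvdz_mod0P srp.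
  by move: sr; rewrite eqz_mod_dvd; move/dvdz_mod0P: srp => ->.
have UW0 : (U :&: W = 0)%VS.
  apply/eqP; rewrite -subv0; apply/subvP => v; rewrite memv_cap => /andP[vU vW].
  by rewrite memv0 -(W0 _ vW) (eig_avg_eig _ vU) subrr dvdz0 eqxx.
have xUW : x \in (U + W)%VS.
  rewrite -[x]sum_eig_avg; apply: memv_suml => s _.
  have [sr|sr] := boolP (s%:Z == r %[mod p])%Z.
    rewrite -[eig_avg s x]addr0 memv_add ?mem0v //.
    by rewrite /U -(eig_mod (eqP sr)) eig_avg_mem.
  rewrite -[eig_avg s x]add0r memv_add ?mem0v //.
  by apply: (subvP (sumv_sup s sr (subvv _))); exact: eig_avg_mem.
have Px : P r x \in U by exact: memv_pi.
have xE : P r x + daddv_pi W U x = x by exact: daddv_pi_add.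
rewrite -[x in RHS]xE -[RHS]/(avg _) linearD /= (eig_avg_eig _ Px) subrr dvdz0.
by rewrite W0 ?memv_pi // addr0.
Qed.

Lemma eig_proj_comp r s x :
  P r (P s x) = if (p %| s - r)%Z then P s x else 0.
Proof. by rewrite !eig_projE (eig_avg_eig _ (eig_avg_mem s x)). Qed.

Lemma sum_eig_proj x : \sum_(r < p) P r x = x.
Proof. by under eq_bigr do rewrite eig_projE; exact: sum_eig_avg. Qed.

(** By isometry, eigenspaces of non-inverse eigenvalues are orthogonal. *)
Lemma form_eig r s x y : x \in eig r -> y \in eig s -> ~~ (p %| r + s)%Z ->
  form x y = 0.
Proof.
rewrite !memv_eig => /eqP xr /eqP ys prs.
have := nu_isom x y; rewrite xr ys linearZl_LR linearZr_LR /= mulrA => /eqP.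
rewrite -expfzDr // -subr_eq0 -{2}[form x y]mul1r -mulrBl mulf_eq0 subr_eq0.
by rewrite omega_eq1 (negPf prs) => /eqP.
Qed.

Lemma form_eig_proj r x y : form (P r x) y = form (P r x) (P (- r) y).
Proof.
rewrite -[y in LHS]sum_eig_proj linear_sumr /=.
have p0 : p%:Z != 0 by move: p_gt0; lia.
have rp : 0 <= (- r %% p)%Z by exact: modz_ge0.
have rlt : (absz (- r %% p)%Z < p)%N.
  by have := @ltz_pmod (- r) p; move: p_gt0 rp; lia.
rewrite (bigD1 (Ordinal rlt)) //= big1 ?addr0 => [|s sr].
  by rewrite (@eig_proj_mod (Ordinal rlt) (- r)) //= gez0_abs // modz_mod.
apply: (form_eig (memv_pi _ _ _) (memv_pi _ _ _)).
apply: contraNN sr => prs; apply/eqP/val_inj => /=.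
have : (s = - r %[mod p])%Z by apply/eqP; rewrite eqz_mod_dvd opprK addrC.
by rewrite modz_small; [move=> <-; rewrite absz_nat | have := ltn_ord s; lia].
Qed.

Lemma eig_proj_adj r x y : form (P r x) y = form x (P (- r) y).
Proof.
have sym u v : form u v = form v u by rewrite hermC expr0 mul1r.
by rewrite form_eig_proj [RHS]sym [RHS]form_eig_proj opprK sym.
Qed.

Section OrthonormalBasis.
Variables (d : nat) (alpha : d.-tuple h).
Hypothesis alpha_basis : basis_of {:h} alpha.
Hypothesis alpha_orthonormal : forall q r : 'I_d,
  form (tnth alpha q) (tnth alpha r) = (q == r)%:R.

Lemma orthonormal_exp x : x = \sum_(q < d) form (tnth alpha q) x *: tnth alpha q.
Proof.
rewrite {1}(coord_basis alpha_basis (memvf x)).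
apply: eq_bigr => q _; rewrite -tnth_nth; congr (_ *: _).
rewrite {2}(coord_basis alpha_basis (memvf x)) linear_sumr (bigD1 q) //=.
rewrite linearZr_LR /= -tnth_nth alpha_orthonormal eqxx mulr1 big1 ?addr0 //.
move=> r rq; rewrite linearZr_LR /= -tnth_nth alpha_orthonormal eq_sym.
by rewrite (negPf rq) mulr0.
Qed.

(** The trace of the projection on an eigenspace is its dimension. *)
Lemma sum_form_eig_proj r :
  \sum_(q < d) form (P r (tnth alpha q)) (tnth alpha q) = (\dim (eig r))%:R.
Proof.
pose b := vbasis (eig r).
have bP (k : 'I_(\dim (eig r))) : b`_k \in eig r.
  by apply: vbasis_mem; rewrite mem_nth // size_tuple.
have sym u v : form u v = form v u by rewrite hermC expr0 mul1r.
have PE q : form (P r (tnth alpha q)) (tnth alpha q) =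
    \sum_k coord b k (P r (form (tnth alpha q) b`_k *: tnth alpha q)).
  rewrite {1}(coord_vbasis (memv_pi _ _ (tnth alpha q))) linear_sumlz /=.
  apply: eq_bigr => k _; rewrite linearZl_LR linearZ /= linearZ /= mulrC.
  by rewrite sym.
under eq_bigr do rewrite PE.
rewrite exchange_big /= -[RHS]mulr1 mulr_natl -[in RHS](card_ord (\dim _)).
rewrite -sumr_const; apply: eq_bigr => k _.
transitivity (coord b k (P r b`_k)).
  by rewrite [in RHS](orthonormal_exp b`_k) !linear_sum.
rewrite eig_projE (eig_avg_eig _ (bP k)) subrr dvdz0 coord_free ?eqxx //.
exact: basis_free (vbasisP _).
Qed.

End OrthonormalBasis.
End EigenProjections.

(** * The twisted Fock space as a Heisenberg module *)

(** Every element of a free algebra is reached from [1] by linear combinations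
    and left multiplications by generators. *)
Lemma free_alg_ind (K : fieldType) (X : choiceType) (Q : free_alg K X -> Prop) :
  Q 0 -> (forall a u v, Q u -> Q v -> Q (a *: u + v)) -> Q 1 ->
  (forall x v, Q v -> Q (free_gen K x * v)) -> forall w, Q w.
Proof.
move=> Q0 QD Q1 Qgen w; rewrite [w]monalgE.
have Qm (s : seq X) : Q << FMonom s >>.
  elim: s => [|x s IHs].
    have -> : FMonom [::] = mone :> {fmonom X} by apply: val_inj; rewrite /= fm1.
    exact: Q1.
  have -> : << FMonom (x :: s) >> = free_gen K x * << FMonom s >>.
    rewrite malgM_def fgmulUU mulr1; congr << _ >>.
    by apply: val_inj; rewrite /= fmM fmU.
  exact: Qgen.
elim/big_ind: _ => [//|u v Qu Qv|m _]; first by rewrite -[u]scale1r; exact: QD.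
have -> : << w@_m *g m >> = w@_m *: << m >> + 0.
  by apply/malgP => k; rewrite addr0 mcoeffZ !mcoeffU mulr_natr.
by apply: QD Q0; rewrite -[m]fmK; exact: Qm.
Qed.

Section InducedModule.
Variables (K : fieldType) (g : lmodType K) (br : g -> g -> g).
Variables (b : set g) (chi : g -> K).

Local Notation act := (@ind_act K g br b chi).
Local Notation ind := (ind br b chi).
Local Notation pi := (lpi (ind_ideal (br := br) b chi)).

Lemma env_scalerAl (a : K) (u v : env br) : (a *: u) * v = a *: (u * v).
Proof.
rewrite -[u]lpiK -[v]lpiK -linearZ /= -[LHS]env_mulE -[_ * _ in RHS]env_mulE.
by rewrite -linearZ scalerAl.
Qed.

Let piP a u v : pi (a *: u + v) = a *: pi u + pi v.
Proof. exact: lpi_linear. Qed.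

Let piD u v : pi (u + v) = pi u + pi v. Proof. exact: lpiD. Qed.

Lemma ind_act_linearr x a u v :
  act x (a *: u + v) = a *: act x u + act x v.
Proof.
rewrite -(lpiK u) -(lpiK v); move: (repr u) (repr v) => u' v'.
transitivity (act x (pi (a *: u' + v'))); first by congr (act x _); exact/esym/piP.
by rewrite !ind_actE mulrDr env_scalerAr; exact: piP.
Qed.

Lemma ind_act_linearl (v : ind) a x y :
  act (a *: x + y) v = a *: act x v + act y v.
Proof.
rewrite -(lpiK v) !ind_actE; move: (repr v) => v'.
by rewrite env_gen_linear mulrDl env_scalerAl; exact: piP.
Qed.

Lemma ind_act_bracket x y (v : ind) :
  act x (act y v) = act y (act x v) + act (br x y) v.
Proof.
rewrite -(lpiK v) !ind_actE -piD env_gen_bracket mulrBl !mulrA; congr (pi _).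
by rewrite addrC subrK.
Qed.

Lemma ind_act0l (v : ind) : act 0 v = 0.
Proof. exact: (lin0 (ind_act_linearl v)). Qed.

Lemma ind_act_comm x y (v : ind) : br x y = 0 -> act x (act y v) = act y (act x v).
Proof. by move=> xy; rewrite ind_act_bracket xy ind_act0l addr0. Qed.

(** Induction on an induced module, starting from the vacuum vector. *)
Lemma ind_ind (Q : ind -> Prop) : Q 0 ->
  (forall a u v, Q u -> Q v -> Q (a *: u + v)) ->
  Q (ind_vac br b chi) -> (forall x v, Q v -> Q (act x v)) ->
  forall v, Q v.
Proof.
move=> Q0 QD Qvac Qact v; rewrite -[v]lpiK -[repr v]lpiK.
move: (repr (repr v)) => w; pose F := lpi (env_ideal br).
suff : Q (pi (F w)) by [].
elim/free_alg_ind: w => [|a u w Qu Qw||x w Qw].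
- by rewrite /F !linear0.
- have -> : F (a *: u + w) = a *: F u + F w by exact: lpi_linear.
  by rewrite piP; exact: QD.
- exact: Qvac.
- have -> : F (free_gen K x * w) = env_gen br x * F w by exact: env_mulE.
  by rewrite -ind_actE; exact: Qact.
Qed.

End InducedModule.

Section FockSpace.
Variables (K : fieldType) (h : vectType K) (form : {symmetric h}).
Variables (nu : 'End(h)) (omega : K) (p : nat).
Hypothesis p_neq0 : p%:R != 0 :> K.
Hypothesis omega_prim : p.-primitive_root omega.
Hypothesis nu_isom : isometry form form nu.
Hypothesis nu_period : forall x, iter p nu x = x.

Local Notation S := (fock form nu omega p).
Local Notation P := (eig_proj nu omega p).
Local Notation mode := (@mode K h form nu omega p).
Local Notation aff := (affine nu omega).
Local Notation act :=
  (@ind_act K aff (@affine_br K h form nu omega p) (@affine_nneg K h nu omega)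
     (@affine_char K h nu omega)).

Lemma mode_linearr x N a (u v : S) :
  mode x N (a *: u + v) = a *: mode x N u + mode x N v.
Proof. exact: ind_act_linearr. Qed.

Lemma mode_linearl N (v : S) a x y :
  mode (a *: x + y) N v = a *: mode x N v + mode y N v.
Proof.
rewrite /mode -ind_act_linearl; congr (ind_act _ _); congr (_, _).
  apply/val_inj/funext => M /=.
  rewrite -[RHS]/(a *: (if M == N then P N x else 0) +
                  (if M == N then P N y else 0)).
  by case: eqP => _; rewrite ?linearP // scaler0 addr0.
by rewrite /= scaler0 addr0.
Qed.

Lemma loop_finite (f : loop nu omega) : exists B : nat,
  forall N, (B < `|N|)%N -> f N = 0.
Proof.
case: f => f /= /asboolP[/finite_seqP[s sE] _].
exists (\max_(N <- s) `|N|)%N => N BN; apply/eqP; apply: contraTT BN => fN.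
have Ns : N \in s by have : [set` s] N by rewrite -sE.
by rewrite -leqNgt; apply: leq_bigmax_seq.
Qed.

(** The central element [C] acts as [1]. *)
Lemma act_central (c : K) (v : S) : act (0, c) v = c *: v.
Proof.
have bE (x : aff) : affine_br form p (0, c) x = 0 /\ affine_br form p x (0, c) = 0.
  rewrite /affine_br; split; congr (_, _); apply: fsum0 => N /=.
    by rewrite linear0l mul0r.
  by rewrite linear0r mul0r.
pose Q v := act (0, c) v = c *: v.
apply: (ind_ind (Q := Q)); rewrite /Q.
- by rewrite (lin0 (ind_act_linearr _)) scaler0.
- by move=> a u w Qu Qw; rewrite ind_act_linearr Qu Qw scalerDr !scalerA mulrC.
- by rewrite ind_act_vac // => N _ /=.
- move=> x w Qw; transitivity (act x (act (0, c) w)).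
    exact: ind_act_comm (bE x).1.
  by rewrite Qw; exact: (linZ (ind_act_linearr _)).
Qed.

(** The canonical commutation relations, [M] and [N] standing for the exponents
    [M / p] and [N / p]. *)
Lemma mode_comm x M y N (v : S) :
  mode x M (mode y N v) = mode y N (mode x M v) +
    (if M + N == 0 then M%:~R / p%:R * form (P M x) y else 0) *: v.
Proof.
rewrite {1 2}/mode ind_act_bracket; congr (_ + _).
rewrite -act_central; congr (act (_, _) v).
rewrite (fsum1 (i := M)) /= => [|N' /negPf ->]; last by rewrite linear0l mul0r.
rewrite eqxx (_ : (- M == N) = (M + N == 0)); last by lia.
have [MN|_] := eqVneq; last by rewrite linear0r mul0r.
have -> : N = - M by lia.
by rewrite -form_eig_proj // mulrC.
Qed.

(** The mode of index [N] only sees the component of degree [N] modulo [p]. *)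
Lemma mode_proj x M N (v : S) :
  mode (P M x) N v = if (p %| M - N)%Z then mode x N v else 0.
Proof.
have monoE : loop_mono nu omega p (P M x) N =
    if (p %| M - N)%Z then loop_mono nu omega p x N else 0.
  apply/val_inj/funext => L /=.
  rewrite eig_proj_comp //; case MN : (p %| M - N)%Z; last by rewrite if_same.
  have -> // : P M = P N.
  by apply: eig_proj_mod => //; apply/eqP; rewrite eqz_mod_dvd.
rewrite /mode monoE; case: ifP => // _; exact: (ind_act0l _).
Qed.

(** Each vector is annihilated by the modes of large positive index. This is
    what makes the sums over modes finite. *)
Lemma mode_nilpotent (v : S) :
  exists B : nat, forall x N, B%:Z < N -> mode x N v = 0.
Proof.
pose Q v := exists B : nat, forall x N, B%:Z < N -> mode x N v = 0.
apply: (ind_ind (Q := Q)); rewrite /Q.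
- by exists 0%N => x N _; exact: (lin0 (mode_linearr x N)).
- move=> a u w [B1 Q1] [B2 Q2]; exists (maxn B1 B2) => x N BN.
  rewrite (mode_linearr x N a u w) Q1 ?Q2; [|lia|lia].
  by rewrite scaler0; exact: addr0.
- exists 0%N => x N N0; rewrite /mode ind_act_vac; first exact: scale0r.
  by move=> M M0 /=; case: eqP => // MN; move: N0 M0; lia.
- move=> y w [B Qw]; have [C yC] := loop_finite y.1.
  exists (maxn B C) => x N BN; rewrite /mode ind_act_comm.
    rewrite -[X in act y X]/(mode x N w) Qw; last lia.
    exact: (lin0 (ind_act_linearr y)).
  congr (0, _); apply: fsum0 => M /=; case: eqP => [->|_].
    by rewrite yC ?linear0r ?mul0r //; lia.
  by rewrite linear0l mul0r.
Qed.

End FockSpace.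

(** * Commutators of normal ordered quadratics *)

Section HeisenbergModule.
Variables (K : fieldType) (h : lmodType K) (form : {symmetric h}) (p d : nat).
Variables (V : lmodType K) (a : h -> int -> V -> V) (P : int -> h -> h).
Variables (alpha : 'I_d -> h) (D : int -> K).

(** The scalar [[a x M, a y N]]. *)
Definition pairing (M : int) (x : h) (N : int) (y : h) : K :=
  if M + N == 0 then M%:~R / p%:R * form (P M x) y else 0.

(** Operators [a x N], linear in [x], satisfying the commutation relations
    of the modes of a twisted Heisenberg algebra, together with the properties
    of the projections [P M] on the eigenspaces and of the orthonormal basis
    [alpha] that the commutators of quadratics depend on. *)
Record twisted_heisenberg : Prop := TwistedHeisenberg {
  heis_linr : forall x N c u v, a x N (c *: u + v) = c *: a x N u + a x N v;
  heis_linl : forall N v c x y,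
    a (c *: x + y) N v = c *: a x N v + a y N v;
  heis_comm : forall x M y N v,
    a x M (a y N v) = a y N (a x M v) + pairing M x N y *: v;
  heis_proj : forall x M N v,
    a (P M x) N v = if (p %| M - N)%Z then a x N v else 0;
  heis_nilpotent : forall v,
    exists B : nat, forall x N, B%:Z < N -> a x N v = 0;
  heis_adj : forall M x y, form (P M x) y = form x (P (- M) y);
  heis_exp : forall x, x = \sum_q form (alpha q) x *: alpha q;
  heis_trace : forall M, \sum_q form (P M (alpha q)) (alpha q) = D M;
  heis_period : forall M N, (p %| M - N)%Z -> D M = D N
}.

Hypothesis aH : twisted_heisenberg.

Let a_linr := heis_linr aH.
Let a_linl := heis_linl aH.
Let a_comm := heis_comm aH.
Let a_proj := heis_proj aH.
Let a_nilpotent := heis_nilpotent aH.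
Let P_adj := heis_adj aH.
Let alpha_exp := heis_exp aH.
Let P_trace := heis_trace aH.
Let D_period := heis_period aH.

(** The normal ordered product of two modes. *)
Definition nprod (x : h) (M : int) (y : h) (N : int) : V -> V :=
  if 0 < M then a y N \o a x M else a x M \o a y N.

(** [quad M N] and [nquad M N]: the sums over the orthonormal basis of the
    products, resp. normal ordered products, of the modes [M] and [N]. *)
Definition quad (M N : int) (v : V) := \sum_q a (alpha q) M (a (alpha q) N v).
Definition nquad (M N : int) (v : V) :=
  \sum_q nprod (alpha q) M (alpha q) N v.

(** The coefficient of [x^N] in [1/2 \sum_q :alpha_q<x> alpha_q<x>:], the
    product of the modes [M] and [- N - M] being weighted by [c M]. *)
Definition wquad (c : int -> K) (N : int) (v : V) :=
  2^-1 *: \sum_(M \in [set: int]) c M *: nquad M (- N - M) v.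

Let wquadE c N v :
  wquad c N v = 2^-1 *: \sum_(M \in [set: int]) c M *: nquad M (- N - M) v.
Proof. by []. Qed.

Let a_lin x N := a_linr x N.

Lemma nprod_lin x M y N c u v :
  nprod x M y N (c *: u + v) = c *: nprod x M y N u + nprod x M y N v.
Proof. by rewrite /nprod; case: ifP => _ /=; rewrite !a_linr. Qed.

Lemma nquad_lin M N c u v :
  nquad M N (c *: u + v) = c *: nquad M N u + nquad M N v.
Proof.
rewrite /nquad scaler_sumr -big_split /=; apply: eq_bigr => q _.
exact: nprod_lin.
Qed.

Lemma form_sym x y : form x y = form y x.
Proof. by rewrite hermC expr0 mul1r. Qed.

Lemma heis_opp M : D (- M) = D M.
Proof.
rewrite -!P_trace; apply: eq_bigr => q _.
by rewrite P_adj opprK form_sym.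
Qed.

Lemma a_sum (c : 'I_d -> K) N v :
  a (\sum_q c q *: alpha q) N v = \sum_q c q *: a (alpha q) N v.
Proof.
rewrite (lin_sum (f := fun x => a x N v)) //.
by apply: eq_bigr => q _; rewrite (linZ (f := fun x => a x N v)).
Qed.

Lemma a_exp x N v :
  a x N v = \sum_q form (alpha q) x *: a (alpha q) N v.
Proof. by rewrite {1}[x]alpha_exp a_sum. Qed.

(** The eigenspaces of the two modes are dual only if [p] divides [M + N]. *)
Lemma quad_eq0 M N v : ~~ (p %| M + N)%Z -> quad M N v = 0.
Proof.
move=> pMN; rewrite /quad.
have aE q : a (alpha q) N v =
    \sum_r form (P (- N) (alpha r)) (alpha q) *: a (alpha r) N v.
  have -> : a (alpha q) N v = a (P N (alpha q)) N v by rewrite a_proj subrr dvdz0.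
  by rewrite a_exp; apply: eq_bigr => r _; rewrite P_adj opprK.
under eq_bigr => q _.
  rewrite aE (lin_sum (a_lin _ _)); under eq_bigr do rewrite (linZ (a_lin _ _)).
  over.
rewrite exchange_big big1 //= => r _.
under eq_bigr do rewrite form_sym.
rewrite -a_exp a_proj ifN //.
have -> : - N - M = - (M + N) by lia.
by rewrite dvdzE abszN.
Qed.

(** Normal ordering changes a product by a scalar, the trace of a projection. *)
Lemma quad_nquad M N v : quad M N v = nquad M N v +
  (if (0 < M) && (M + N == 0) then M%:~R / p%:R * D M else 0) *: v.
Proof.
rewrite /quad /nquad /nprod; case: ltP => M0 /=; last by rewrite scale0r addr0.
rewrite -P_trace; under eq_bigr do rewrite a_comm.
rewrite big_split /= -scaler_suml /pairing; congr (_ + _ *: _).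
by case: eqP => _; [rewrite mulr_sumr | rewrite big1].
Qed.

(** Two modes fail to commute only if their indices are opposite and nonzero,
    in which case normal ordering fixes their order. *)
Lemma nquadC M N v : nquad M N v = nquad N M v.
Proof.
apply: eq_bigr => q _; rewrite /nprod.
have aC M' N' : (M' + N' == 0 -> M' = 0) ->
    a (alpha q) M' (a (alpha q) N' v) = a (alpha q) N' (a (alpha q) M' v).
  move=> M'0; rewrite a_comm /pairing; case: eqP => [/eqP/M'0 ->|_].
    by rewrite mul0r mul0r scale0r addr0.
  by rewrite scale0r addr0.
case: ltP => M0; case: ltP => N0 //=; apply: aC => /eqP; lia.
Qed.

Lemma nquad_eq0 M N v : ~~ (p %| M + N)%Z -> nquad M N v = 0.
Proof.
move=> pMN; have := quad_eq0 v pMN; rewrite quad_nquad.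
case: (M + N =P 0) => [MN|_]; first by rewrite MN dvdz0 in pMN.
by rewrite andbF scale0r addr0.
Qed.

Lemma nquad_fin T v : fin_supp (fun M => nquad M (T - M) v).
Proof.
have [B a0] := a_nilpotent v; apply: (@fin_supp_int _ (B + `|T|)%N) => M BM.
rewrite /nquad big1 // => q _; rewrite /nprod; case: ltP => M0 /=.
  by rewrite (a0 _ M) ?(lin0 (a_lin _ _)) //; lia.
by rewrite (a0 _ (T - M)) ?(lin0 (a_lin _ _)) //; lia.
Qed.

Lemma wquad_fin c N v : fin_supp (fun M => c M *: nquad M (- N - M) v).
Proof. by apply: fin_suppW (nquad_fin (- N) v) => M ->; rewrite scaler0. Qed.

Lemma wquad_lin c N b u v :
  wquad c N (b *: u + v) = b *: wquad c N u + wquad c N v.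
Proof.
rewrite /wquad scalerA mulrC -scalerA -scalerDr; congr (_ *: _).
rewrite (fsumZ b (wquad_fin _ _ _)) -fsumD; last exact: wquad_fin.
  apply: eq_fsum => M.
  by rewrite nquad_lin scalerDr !scalerA mulrC.
by apply: fin_suppW (wquad_fin c N u) => M ->; rewrite scaler0.
Qed.

Lemma a_nprod x L y M z N v : a x L (nprod y M z N v) =
  nprod y M z N (a x L v) +
  (pairing L x M y *: a z N v + pairing L x N z *: a y M v).
Proof.
rewrite /nprod; case: ifP => _ /=; rewrite !(a_comm x L) !(linD (a_lin _ _)).
  by rewrite !(linZ (a_lin _ _)) addrA addrAC -!addrA.
by rewrite !(linZ (a_lin _ _)) -!addrA; congr (_ + _); rewrite addrC.
Qed.

Lemma sum_pairing x L M N v :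
  \sum_q pairing L x M (alpha q) *: a (alpha q) N v =
  if (L + M == 0) && (p %| L - N)%Z then (L%:~R / p%:R) *: a x N v else 0.
Proof.
rewrite /pairing; case: eqP => [_|_] /=; last first.
  by rewrite big1 // => q _; rewrite scale0r.
under eq_bigr do rewrite -scalerA form_sym.
rewrite -scaler_sumr -a_exp a_proj; case: ifP => _ //; exact: scaler0.
Qed.

(** A mode and a quadratic have a mode as commutator: in the sum defining the
    quadratic only the terms [M = - L] and [M = L - N] contribute. *)
Lemma a_wquad x L c N v : a x L (wquad c N v) = wquad c N (a x L v) +
  (if (p %| N)%Z then 2^-1 * (L%:~R / p%:R) * (c (- L) + c (L - N)) else 0) *:
  a x (L - N) v.
Proof.
rewrite /wquad (linZ (a_lin _ _)) (lin_fsum (a_lin _ _)); last exact: wquad_fin.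
pose X := if (p %| N)%Z then (L%:~R / p%:R) *: a x (L - N) v else 0.
have termE M : a x L (c M *: nquad M (- N - M) v) =
    c M *: nquad M (- N - M) (a x L v) +
    ((if M == - L then c M *: X else 0) + (if M == L - N then c M *: X else 0)).
  rewrite (linZ (a_lin _ _)) (lin_sum (a_lin _ _)).
  under eq_bigr do rewrite a_nprod.
  rewrite big_split scalerDr /=; congr (_ + _).
  rewrite big_split scalerDr /= !sum_pairing /X; congr (_ + _).
    rewrite (_ : (L + M == 0) = (M == - L)); last lia.
    case: eqP => [->|_] /=; last by rewrite scaler0.
    have -> : - N - - L = L - N by lia.
    by have -> : L - (L - N) = N by lia.
  rewrite (_ : (L + (- N - M) == 0) = (M == L - N)); last lia.
  case: eqP => [->|_] /=; last by rewrite scaler0.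
  by have -> : L - (L - N) = N by lia.
under eq_fsum do rewrite termE.
have fin1 (M0 : int) : fin_supp (fun M => if M == M0 then c M *: X else 0).
  by exists [:: M0] => M; rewrite inE => /negPf ->.
rewrite fsumD; [|exact: wquad_fin|exact: fin_suppD].
rewrite scalerDr; congr (_ + _); rewrite fsumD //.
rewrite (fsum1 (i := - L)) => [|M /negPf -> //]; rewrite eqxx.
rewrite (fsum1 (i := L - N)) => [|M /negPf -> //]; rewrite eqxx.
rewrite -scalerDl scalerA /X; case: ifP => _; last by rewrite scaler0 scale0r.
by rewrite scalerA mulrAC.
Qed.

Lemma quad_wquad M M' c N v : quad M M' (wquad c N v) =
  wquad c N (quad M M' v) + (if (p %| N)%Z then 2^-1 *:
    ((M%:~R / p%:R * (c (- M) + c (M - N))) *: quad (M - N) M' v +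
     (M'%:~R / p%:R * (c (- M') + c (M' - N))) *: quad M (M' - N) v) else 0).
Proof.
rewrite /quad (lin_sum (wquad_lin _ _)).
under eq_bigr do rewrite a_wquad (linD (a_lin _ _)) a_wquad (linZ (a_lin _ _)).
rewrite big_split big_split /= -addrA; congr (_ + _).
case: ifP => _; last by rewrite !big1 ?addr0 // => q _; rewrite scale0r.
by rewrite -!scaler_sumr scalerDr !scalerA !mulrA.
Qed.

Lemma nquad_wquad M M' c N v : nquad M M' (wquad c N v) =
  wquad c N (nquad M M' v) + (if (p %| N)%Z then 2^-1 *:
    ((M%:~R / p%:R * (c (- M) + c (M - N))) *: quad (M - N) M' v +
     (M'%:~R / p%:R * (c (- M') + c (M' - N))) *: quad M (M' - N) v) else 0).
Proof.
have := quad_wquad M M' c N v; rewrite !quad_nquad (linD (wquad_lin _ _)).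
by rewrite (linZ (wquad_lin _ _)) addrAC => /addIr.
Qed.

(** The coefficient of the scalar term of the commutator of two [wquad]s of
    opposite weights. *)
Definition anomaly (c1 c2 : int -> K) (N1 : int) : K :=
  \sum_(M \in [set: int]) (M%:~R / p%:R) * ((- N1 - M)%:~R / p%:R) * D M *
    (((0 < M)%R%:R - (0 < M + N1)%R%:R) * (c1 M * (c2 (- M) + c2 (M + N1)))).

(** The commutator of two quadratics. It is first obtained as a sum of products
    that are not normal ordered; normal ordering them produces the anomaly. The
    terms containing the mode [- N1 - M] are reindexed, so that all products have
    the modes [M] and [- T - M]. *)
Lemma wquad_comm c1 (N1 : int) c2 (N2 : int) v (T := N1 + N2) :
  wquad c1 N1 (wquad c2 N2 v) - wquad c2 N2 (wquad c1 N1 v) =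
  if (p %| N2)%Z then 4^-1 *:
    (\sum_(M \in [set: int])
       ((- N1 - M)%:~R / p%:R *
        ((c1 (- N1 - M) + c1 M) * (c2 (N1 + M) + c2 (- T - M)))) *:
       nquad M (- T - M) v +
     (if T == 0 then anomaly c1 c2 N1 else 0) *: v)
  else 0.
Proof.
rewrite (wquadE c1 N1 v) (wquadE c1 N1 (wquad _ _ _)) (linZ (wquad_lin _ _)).
rewrite -scalerBr (lin_fsum (wquad_lin _ _)); last exact: wquad_fin.
rewrite -fsumB; first last.
- by apply: fin_suppW (wquad_fin c1 N1 v) => M ->; exact: (lin0 (wquad_lin _ _)).
- exact: wquad_fin.
under eq_fsum do rewrite (linZ (wquad_lin _ _)) -scalerBr nquad_wquad addrAC
  subrr add0r.
case: ifP => pN2; last by rewrite fsum0 ?scaler0 // => M; rewrite scaler0.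
pose s M : K := if T == 0 then (M%:~R / p%:R) * ((- N1 - M)%:~R / p%:R) * D M *
  (((0 < M)%R%:R - (0 < M + N1)%R%:R) * (c1 M * (c2 (- M) + c2 (M + N1)))) else 0.
pose e1 (M : int) := (- N1 - M)%:~R / p%:R * (c1 (- N1 - M) *
   (c2 (N1 + M) + c2 (- T - M))).
pose e2 (M : int) := (- N1 - M)%:~R / p%:R * (c1 M *
   (c2 (N1 + M) + c2 (- T - M))).
pose r (M : int) := - N1 - M.
have rK : involutive r by move=> M; rewrite /r; lia.
have termE M : c1 M *: (2^-1 *:
     ((M%:~R / p%:R * (c2 (- M) + c2 (M - N2))) *: quad (M - N2) (- N1 - M) v +
      ((- N1 - M)%:~R / p%:R * (c2 (- (- N1 - M)) + c2 (- N1 - M - N2))) *: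
        quad M (- N1 - M - N2) v)) =
   2^-1 *: (e1 (r M) *: nquad (r M) (- T - r M) v + e2 M *: nquad M (- T - M) v +
      s M *: v).
  rewrite scalerA [c1 M * _]mulrC -[LHS]scalerA; congr (_ *: _).
  have -> : - (- N1 - M) = N1 + M by lia.
  have -> : - N1 - M - N2 = - T - M by rewrite /T; lia.
  rewrite !quad_nquad [nquad (M - N2) _ v]nquadC /e1 /e2 /s /r.
  have -> : - N1 - (- N1 - M) = M by lia.
  have -> : N1 + (- N1 - M) = - M by lia.
  have -> : - T + (N1 + M) = M - N2 by rewrite /T; lia.
  have -> : (M - N2 + (- N1 - M) == 0) = (T == 0) by rewrite /T; lia.
  have -> : (M + (- T - M) == 0) = (T == 0) by rewrite /T; lia.
  rewrite !scalerDr !scalerA.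
  set x := nquad _ _ v; set y := nquad _ _ v.
  rewrite addrACA -scalerDl.
  congr (_ *: _ + _ *: _ + _ *: _); [|exact: mulrCA|].
    have -> : - T - (- N1 - M) = M - N2 by rewrite /T; lia.
    exact: mulrCA.
  case: (T =P 0) => [T0|_]; last by rewrite !andbF !mulr0 addr0.
  rewrite !andbT.
  have N2E : M - N2 = M + N1 by move: T0; rewrite /T; lia.
  have TME : - T - M = - M by rewrite T0; lia.
  have NE : N1 + M = M + N1 by exact: addrC.
  have DE : D (M + N1) = D M.
    apply: D_period; have -> : M + N1 - M = - N2 by move: T0; rewrite /T; lia.
    by rewrite dvdzE abszN.
  rewrite N2E NE TME DE.
  have -> : - N1 - M = - (M + N1) by lia.
  by case: (0 < M); case: (0 < M + N1); rewrite ?mulrNz /=; ring.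
under eq_fsum do rewrite termE.
have f1 : fin_supp (fun M => e1 (r M) *: nquad (r M) (- T - r M) v).
  apply: (fin_supp_can rK (f := fun M => e1 M *: nquad M (- T - M) v)).
  by apply: fin_suppW (nquad_fin (- T) v) => M ->; rewrite scaler0.
have f2 : fin_supp (fun M => e2 M *: nquad M (- T - M) v).
  by apply: fin_suppW (nquad_fin (- T) v) => M ->; rewrite scaler0.
have f3' : fin_supp s.
  apply: (@fin_supp_int _ `|N1|%N) => M MN1; rewrite /s; case: ifP => // _.
  (* only the M between 0 and - N1 contribute *)
  have -> : (0 < M) = (0 < M + N1) by lia.
  by rewrite subrr mul0r mulr0.
have f3 : fin_supp (fun M => s M *: v).
  by apply: fin_suppW f3' => M ->; rewrite scale0r.
rewrite -fsumZ; last by apply: fin_suppD => //; apply: fin_suppD.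
rewrite scalerA -invfM -natrM; congr (_ *: _).
rewrite (fsumD (fin_suppD f1 f2) f3) (fsumD f1 f2).
congr (_ + _); last first.
  rewrite -(fsum_morph (L := fun c => c *: v)) ?scale0r //; last first.
    by move=> c c'; rewrite scalerDl.
  by congr (_ *: _); rewrite /s /anomaly; case: ifP => // _; apply: fsum0.
rewrite -(fsum_reindex (fun M => e1 M *: nquad M (- T - M) v) rK rK).
rewrite -fsumD //; last by apply: fin_suppW (nquad_fin (- T) v) => M ->; rewrite scaler0.
by apply: eq_fsum => M; rewrite -scalerDl /e1 /e2; congr (_ *: _); ring.
Qed.

End HeisenbergModule.

(** * Series in several variables *)

Section MultivariateSeries.
Variables (K : fieldType) (n : nat).
Hypothesis K0 : [pchar K] =i pred0.

Implicit Types (c w : 'I_n -> K) (l : 'rV[K]_n) (e u : 'rV[int]_n) (i j : 'I_n).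

Local Notation delta i := (delta_mx 0 i : 'rV[int]_n).
Local Notation deg e := (\sum_i (e : 'rV[int]_n) 0 i).

Lemma natr_neq0 m : (m.+1%:R : K) != 0.
Proof. by rewrite ((pcharf0P K).1 K0). Qed.

Lemma intr_eq0_pchar0 (z : int) : (z%:~R == 0 :> K) = (z == 0).
Proof.
case: z => m; first by rewrite -pmulrn ((pcharf0P K).1 K0).
by rewrite NegzE mulrNz oppr_eq0 -pmulrn (negPf (natr_neq0 m)) oppr_eq0.
Qed.

Lemma add_delta e i j : (e + delta i) 0 j = e 0 j + (j == i)%:R.
Proof. by rewrite !mxE. Qed.

Lemma exp_lin_neg l e i : e 0 i < 0 -> exp_lin l e = 0.
Proof.
move=> ei; rewrite /exp_lin; case: ifP => // /forallP /(_ i).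
by rewrite leNgt ei.
Qed.

Lemma exp_lin0 l : exp_lin l 0 = 1.
Proof.
rewrite /exp_lin ifT; last by apply/forallP => i; rewrite mxE.
by rewrite big1 // => i _; rewrite mxE /= expr0 fact0 divr1.
Qed.

Lemma exp_linS i l e :
  (e 0 i + 1)%:~R * exp_lin l (e + delta i) = l 0 i * exp_lin l e.
Proof.
have [e1|e1] := ltP (e 0 i) (-1).
  by rewrite !(@exp_lin_neg _ _ i) ?mulr0 // ?add_delta ?eqxx; lia.
have [em1|em1] := eqVneq (e 0 i) (-1).
  by rewrite em1 addNr mul0r (@exp_lin_neg _ _ i) ?mulr0 // em1.
have e_ge0 : 0 <= e 0 i by lia.
rewrite /exp_lin.
have -> : [forall j, 0 <= (e + delta i) 0 j] = [forall j, 0 <= e 0 j].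
  apply/forallP/forallP => H j; have := H j; rewrite add_delta.
    by case: eqP => [->|_]; rewrite ?addr0.
  by case: eqP => [->|_]; rewrite ?addr0 //; lia.
case: ifP => _; last by rewrite !mulr0.
rewrite (bigD1 i) //= [in RHS](bigD1 i) //= add_delta eqxx.
rewrite (eq_bigr (fun j => l 0 j ^+ absz (e 0 j) / ((absz (e 0 j))`!)%:R)); last first.
  by move=> j /negPf ji; rewrite add_delta ji addr0.
have -> : absz (e 0 i + true%:R)%R = (absz (e 0 i)).+1 by lia.
have -> : (e 0 i + 1)%:~R = (absz (e 0 i)).+1%:R :> K.
  by rewrite pmulrn; congr (_%:~R); lia.
rewrite factS natrM exprS invfM; set rhs := RHS.
transitivity ((absz (e 0 i)).+1%:R / (absz (e 0 i)).+1%:R * rhs).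
  by rewrite /rhs; ring.
by rewrite divff ?mul1r ?natr_neq0.
Qed.

Lemma deriv_exp_lin i l e :
  deriv_y i (exp_lin l : _ -> K^o) e = l 0 i * exp_lin l e.
Proof. exact: exp_linS. Qed.

Lemma deriv_yC (A : lmodType K) i j (F : 'rV[int]_n -> A) e :
  deriv_y i (deriv_y j F) e = deriv_y j (deriv_y i F) e.
Proof.
rewrite /deriv_y !scalerA !add_delta [j == i]eq_sym [e + _ + delta i]addrAC.
by case: eqP => [->|_] //; rewrite !addr0 mulrC.
Qed.

(** Induction on the exponents of the variables indexed by [A]: a series with
    nonnegative exponents there vanishes if it does so at the exponents that
    are zero on [A], and if its vanishing propagates by unit steps. *)
Lemma transverse_ind (A : pred 'I_n) (F : 'rV[int]_n -> K) :
  (forall e i, A i -> e 0 i < 0 -> F e = 0) ->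
  (forall e, (forall i, A i -> e 0 i = 0) -> F e = 0) ->
  (forall e i, A i -> 0 <= e 0 i ->
    (forall e', (forall j, A j -> e' 0 j = e 0 j) -> F e' = 0) ->
    F (e + delta i) = 0) ->
  forall e, F e = 0.
Proof.
move=> Fneg F0 FS e; have [m] := ubnP (\sum_(i | A i) absz (e 0%R i))%N.
elim: m e => // m IHm e em.
have [/forallP Ae0|] := boolP [forall i, A i ==> (e 0 i == 0)].
  by apply: F0 => i Ai; apply/eqP; have := Ae0 i; rewrite Ai.
move=> /forallPn[k]; rewrite negb_imply => /andP[]; move: k => i Ai ei.
have [e_lt0|e_ge0] := ltP (e 0 i) 0; first exact: Fneg Ai e_lt0.
have -> : e = (e - delta i) + delta i by rewrite subrK.
have eE j : (e - delta i) 0 j = e 0 j - (j == i)%:R by rewrite !mxE.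
apply: FS => // [|e' e'E]; first by rewrite eE eqxx; lia.
apply: IHm; rewrite ltnS in em; apply: leq_trans em.
rewrite (bigD1 i) //= [in X in (_ < X)%N](bigD1 i) //=.
rewrite e'E // eE eqxx -addSn leq_add //; first by lia.
apply: eq_leq; apply: eq_bigr => j /andP[Aj /negPf ji].
by rewrite e'E // eE ji subr0.
Qed.

Lemma laurent_at_neg i0 l f e i : i != i0 -> e 0 i < 0 ->
  laurent_at i0 l f e = 0.
Proof.
move=> ii0 ei; rewrite laurent_atE /lin_pow; case: ifP; rewrite ?mulr0 //.
by case/andP => _ /forallP /(_ i); rewrite ii0 leNgt ei.
Qed.

Section Convolution.
Variable A : lmodType K.
Implicit Types (F G : 'rV[int]_n -> A).

(** Total degrees bounded below by [- B]. *)
Definition deg_ge (B : nat) F := forall e, deg e < - B%:Z -> F e = 0.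

Lemma deg_sub e u : deg (e - u) = deg e - deg u.
Proof. by rewrite -sumrB; apply: eq_bigr => i _; rewrite !mxE. Qed.

(** A coefficient of the product of an exponential with a series of bounded
    below total degree is a finite sum. *)
Lemma conv_fin l B G e : deg_ge B G ->
  exists r : seq 'rV[int]_n, forall u, u \notin r ->
    exp_lin l u = 0 \/ G (e - u) = 0.
Proof.
move=> GB; pose C := absz (B%:Z + deg e).
exists [seq (\row_i (f i : nat)%:Z) | f : {ffun 'I_n -> 'I_C.+1}] => u ur.
have [/forallP u_ge0|] := boolP [forall i, 0 <= u 0 i]; last first.
  move=> /forallPn[k]; rewrite -ltNge => /exp_lin_neg u0.
  by left.
right; apply: GB; rewrite deg_sub ltNge; apply: contra ur => degu.
have uC i : (absz (u 0%R i) < C.+1)%N.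
  have : u 0 i <= deg u by rewrite (bigD1 i) //= lerDl sumr_ge0.
  by have := u_ge0 i; rewrite /C; move: degu; lia.
pose f0 := [ffun i => Ordinal (uC i)].
have -> : u = \row_i (f0 i : nat)%:Z.
  by apply/rowP => i; rewrite mxE ffunE /= gez0_abs.
apply: (map_f (fun f : {ffun 'I_n -> 'I_C.+1} => \row_i (f i : nat)%:Z)).
by rewrite mem_enum.
Qed.

Lemma conv_fin_supp l B G e : deg_ge B G ->
  fin_supp (fun u => exp_lin l u *: G (e - u)).
Proof.
move=> GB; have [r rP] := conv_fin l e GB; exists r => u /rP[] ->.
  by rewrite scale0r.
by rewrite scaler0.
Qed.

Lemma deriv_deg i B G : deg_ge B G -> deg_ge B.+1 (deriv_y i G).
Proof.
move=> GB e eB; rewrite /deriv_y GB ?scaler0 //.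
have -> : deg (e + delta i) = deg e + 1; last by lia.
under eq_bigr do rewrite add_delta.
rewrite big_split /=; congr (_ + _); rewrite (bigD1 i) //= eqxx big1 ?addr0 //.
by move=> j /negPf ->.
Qed.

(** The Leibniz rule for the product with an exponential. *)
Lemma deriv_conv l B G i e : deg_ge B G ->
  deriv_y i (ser_scale (exp_lin l) G) e =
  l 0 i *: ser_scale (exp_lin l) G e + ser_scale (exp_lin l) (deriv_y i G) e.
Proof.
move=> GB; rewrite {1}/deriv_y {1}/ser_scale (fsumZ _ (conv_fin_supp _ _ GB)).
have GB1 := deriv_deg i GB.
pose t1 u := ((u 0 i)%:~R * exp_lin l u) *: G (e + delta i - u).
have t1fin : fin_supp t1.
  apply: fin_suppW (conv_fin_supp l (e + delta i) GB) => u.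
  by rewrite /t1 -scalerA => ->; rewrite scaler0.
have -> : l 0 i *: ser_scale (exp_lin l) G e = \sum_(u \in [set: 'rV_n]) t1 u.
  have subK : cancel (fun u => u + delta i) (fun u => u - delta i).
    by move=> u; rewrite addrK.
  rewrite (fsum_reindex _ subK (fun u => subrK (delta i) u)).
  rewrite /ser_scale (fsumZ _ (conv_fin_supp _ _ GB)); apply: eq_fsum => u.
  rewrite /t1 scalerA -exp_linS add_delta eqxx; congr (_ *: G _).
  by rewrite opprD addrACA subrr addr0.
rewrite /ser_scale -(fsumD t1fin (conv_fin_supp _ _ GB1)); apply: eq_fsum => u.
have -> : e + delta i - u = e - u + delta i by rewrite addrAC.
rewrite /t1 /deriv_y !scalerA (_ : e + delta i - u = e - u + delta i); last first.
  by rewrite addrAC.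
rewrite -scalerDl mulrC [_ * exp_lin l u]mulrC -mulrDr -intrD.
congr (_ * _%:~R *: _); rewrite !mxE; ring.
Qed.

Lemma conv_neg l i G e : (forall e, e 0 i < 0 -> G e = 0) -> e 0 i < 0 ->
  ser_scale (exp_lin l) G e = 0.
Proof.
move=> Gneg ei; apply: fsum0 => u.
have [ui|ui] := ltP (u 0 i) 0; first by rewrite (exp_lin_neg _ ui) scale0r.
by rewrite Gneg ?scaler0 // !mxE subr_lt0; exact: lt_le_trans ei ui.
Qed.

End Convolution.

Lemma laurent_deg i0 l B f : (forall m : int, m < - B%:Z -> f m = 0) ->
  deg_ge B (laurent_at i0 l f : _ -> K^o).
Proof. by move=> fB e eB; rewrite laurent_atE fB ?mul0r. Qed.

Lemma exp_lin_deg l : deg_ge 0 (exp_lin l : _ -> K^o).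
Proof.
move=> e e0; have [/forallP e_ge0|] := boolP [forall i, 0 <= e 0 i]; last first.
  by move=> /forallPn[k]; rewrite -ltNge => /exp_lin_neg ->.
have : 0 <= deg e by rewrite sumr_ge0.
by move: e0; lia.
Qed.

(** Both sides satisfy [d/dy_i F = (l1 + l2)_i F] for all [i] and have constant
    term [1]. *)
Lemma exp_linD l1 l2 e :
  ser_scale (exp_lin l1) (exp_lin l2 : _ -> K^o) e = exp_lin (l1 + l2) e.
Proof.
pose F e : K^o := ser_scale (exp_lin l1) (exp_lin l2 : _ -> K^o) e -
   exp_lin (l1 + l2) e.
suff : F e = 0 by move/eqP; rewrite subr_eq0 => /eqP.
have Fneg e' i : e' 0 i < 0 -> F e' = 0.
  move=> ei; rewrite /F (exp_lin_neg _ ei) subr0 (@conv_neg _ _ i) //.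
  by move=> u; exact: exp_lin_neg.
have FS e' i : deriv_y i F e' = (l1 + l2) 0 i * F e'.
  have := deriv_conv l1 i e' (@exp_lin_deg l2).
  rewrite /deriv_y /F scalerBr => ->.
  rewrite [X in _ - X]exp_linS mulrBr; congr (_ - _).
  rewrite mxE mulrDl; congr (_ + _).
  rewrite /ser_scale mulr_fsumr; apply: eq_fsum => u.
  rewrite -[X in _ *: X]/(deriv_y i (exp_lin l2 : _ -> K^o) (e' - u)).
  by rewrite deriv_exp_lin; exact: mulrCA.
apply: (@transverse_ind predT F) => [e' i _|e' e'0|e' i _ ei IH].
- exact: Fneg.
- have -> : e' = 0 by apply/rowP => i; rewrite e'0 ?mxE.
  rewrite /F exp_lin0 /ser_scale (fsum1 (i := 0)) => [|u u0].
    by rewrite subr0 !exp_lin0 scale1r subrr.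
  have [i ui] : exists i, u 0 i != 0.
    apply/existsP; rewrite -negb_forall; apply: contra u0 => /forallP u0.
    by apply/eqP/rowP => i; rewrite mxE; apply/eqP.
  have [u_lt|u_ge] := ltP (u 0 i) 0; first by rewrite (exp_lin_neg _ u_lt) scale0r.
  have -> : exp_lin l2 (0 - u) = 0; last by rewrite scaler0.
  by apply: (@exp_lin_neg _ _ i); rewrite !mxE sub0r oppr_lt0 lt_neqAle eq_sym ui.
- have := FS e' i; rewrite IH // mulr0 => /eqP; rewrite /deriv_y scaler_eq0.
  by rewrite intr_eq0_pchar0 => /orP[/eqP|/eqP //]; lia.
Qed.

(** Series determined by their restriction to the [i0]-axis: those with
    nonnegative exponents in the other variables [y_i], for which the
    derivative along [y_i] is [c_i + w_i d/dy_i0]. *)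
Definition transported i0 (c w : 'I_n -> K) (F : 'rV[int]_n -> K^o) :=
  (forall e i, i != i0 -> e 0 i < 0 -> F e = 0) /\
  (forall e i, i != i0 ->
     deriv_y i F e = c i * F e + w i * deriv_y i0 F e).

Lemma transported_eq0 i0 c w F : transported i0 c w F ->
  (forall m, F (m *: delta i0) = 0) -> forall e, F e = 0.
Proof.
move=> [Fneg FS] F0; apply: (@transverse_ind (fun i => i != i0) F) => //.
  move=> e e0; rewrite (_ : e = e 0 i0 *: delta i0) //.
  apply/rowP => i; rewrite !mxE; have [->|ii0] := eqVneq i i0.
    by rewrite eqxx mulr1.
  by rewrite andbF mulr0 e0.
move=> e i ii0 ei IH; have := FS e i ii0.
have Fi0 : F (e + delta i0) = 0.
  by apply: IH => j jj0; rewrite add_delta (negPf jj0) addr0.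
rewrite IH // /deriv_y Fi0 scaler0 !mulr0 addr0 => /eqP.
rewrite scaler_eq0 intr_eq0_pchar0.
by case/orP => /eqP //; lia.
Qed.

Lemma transportedD i0 c w F G : transported i0 c w F -> transported i0 c w G ->
  transported i0 c w (fun e => F e + G e).
Proof.
move=> [Fneg FS] [Gneg GS]; split=> [e i ii0 ei|e i ii0].
  by rewrite (Fneg e i) // (Gneg e i) // addr0.
have := FS e i ii0; have := GS e i ii0; rewrite /deriv_y !scalerDr => -> ->.
by rewrite -[LHS]/(_ + _ + _)%R /GRing.scale /=; ring.
Qed.

Lemma transportedZ i0 c w b F : transported i0 c w F ->
  transported i0 c w (fun e => b * F e).
Proof.
move=> [Fneg FS]; split=> [e i ii0 ei|e i ii0].
  by rewrite (Fneg e i) // mulr0.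
have := FS e i ii0; rewrite /deriv_y /GRing.scale /= => E.
by rewrite mulrCA E; ring.
Qed.

Lemma transported_sum (I : Type) (r : seq I) i0 c w (F : I -> 'rV[int]_n -> K^o) :
  (forall x, transported i0 c w (F x)) ->
  transported i0 c w (fun e => \sum_(x <- r) F x e).
Proof.
move=> FT; elim: r => [|x r IHr].
  split=> [e i _ _|e i _]; rewrite /deriv_y !big_nil //.
  by rewrite !scaler0 !mulr0 addr0.
have := transportedD (FT x) IHr; congr (transported _ _ _ _).
by apply/funext => e; rewrite big_cons.
Qed.

Lemma transported_deriv i0 c w j F : transported i0 c w F ->
  transported i0 c w (deriv_y j F).
Proof.
move=> [Fneg FS]; split=> [e i ii0 ei|e i ii0].
  have [ij|ij] := eqVneq i j; last first.
    by rewrite /deriv_y (Fneg _ i) ?scaler0 // add_delta (negPf ij) addr0.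
  have [em1|em1] := eqVneq (e 0 i) (-1).
    by rewrite /deriv_y -ij em1 addNr scale0r.
  by rewrite /deriv_y (Fneg _ i) ?scaler0 // add_delta ij eqxx -ij; lia.
rewrite deriv_yC [deriv_y i0 _ _]deriv_yC {1}/deriv_y FS // scalerDr.
by rewrite /deriv_y /GRing.scale /=; ring.
Qed.

Lemma transported_exp i0 c w (s : 'rV[K]_n) :
  (forall i, i != i0 -> s 0 i = c i + w i * s 0 i0) ->
  transported i0 c w (exp_lin s).
Proof.
move=> sE; split=> [e i _|e i ii0]; first exact: exp_lin_neg.
by rewrite !deriv_exp_lin sE //; ring.
Qed.

Lemma deriv_conv_laurent i0 i (s v : 'rV[K]_n) (g : int -> K) e B : v 0 i0 != 0 ->
  (forall m : int, m < - B%:Z -> g m = 0) ->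
  deriv_y i (ser_scale (exp_lin s) (laurent_at i0 v g : _ -> K^o)) e =
  s 0 i * ser_scale (exp_lin s) (laurent_at i0 v g : _ -> K^o) e +
  v 0 i * ser_scale (exp_lin s) (laurent_at i0 v (deriv_z g) : _ -> K^o) e.
Proof.
move=> v0 gB; rewrite (deriv_conv _ _ _ (laurent_deg _ _ gB)); congr (_ + _).
rewrite /ser_scale mulr_fsumr; apply: eq_fsum => u.
by rewrite deriv_y_laurent_at //; exact: mulrCA.
Qed.

(** A Laurent series in the linear form [v] times the exponential of [s] is
    transported, the ratios [v_i / v_i0] being the [w_i]. *)
Lemma transported_laurent i0 c w (s v : 'rV[K]_n) (g : int -> K) B : v 0 i0 != 0 ->
  (forall m : int, m < - B%:Z -> g m = 0) ->
  (forall i, i != i0 -> v 0 i = w i * v 0 i0) ->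
  (forall i, i != i0 -> s 0 i = c i + w i * s 0 i0) ->
  transported i0 c w (ser_scale (exp_lin s) (laurent_at i0 v g : _ -> K^o)).
Proof.
move=> v0 gB vE sE; split=> [e i ii0 ei|e i ii0].
  by apply: (@conv_neg _ _ i) => // u; exact: laurent_at_neg.
by rewrite !(deriv_conv_laurent _ _ _ v0 gB) vE // sE //; ring.
Qed.

Lemma exp_lin_axis i0 (s : 'rV[K]_n) (m : int) :
  exp_lin s (m *: delta i0) = exp_z (s 0 i0) m.
Proof.
have dE i : (m *: delta i0) 0 i = if i == i0 then m else 0.
  by rewrite !mxE eqxx /=; case: eqP => _; rewrite ?mulr1 ?mulr0.
rewrite /exp_lin /exp_z.
have -> : [forall i, 0 <= (m *: delta i0) 0 i] = (0 <= m).
  apply/forallP/idP => [/(_ i0)|m0 i]; first by rewrite dE eqxx.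
  by rewrite dE; case: ifP.
case: ifP => // _; rewrite (bigD1 i0) //= dE eqxx big1 ?mulr1 //.
by move=> i /negPf ii0; rewrite dE ii0 /= expr0 fact0 divr1.
Qed.

Lemma laurent_axis i0 (v : 'rV[K]_n) (g : int -> K) (m : int) :
  laurent_at i0 v g (m *: delta i0) = g m * v 0 i0 ^ m.
Proof.
have dE i : (m *: delta i0) 0 i = if i == i0 then m else 0.
  by rewrite !mxE eqxx /=; case: eqP => _; rewrite ?mulr1 ?mulr0.
have degE : deg (m *: delta i0) = m.
  rewrite (bigD1 i0) //= dE eqxx big1 ?addr0 // => i /negPf ii0.
  by rewrite dE ii0.
rewrite laurent_atE degE /lin_pow degE eqxx dE eqxx subrr /= big_ord0 mul1r.
rewrite ifT; last by apply/forallP => i; rewrite dE; case: eqP.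
rewrite big1 ?mulr1 // => i /negPf ii0.
by rewrite dE ii0 /= expr0 fact0 divr1.
Qed.

Lemma conv_laurent_axis i0 (s v : 'rV[K]_n) (g : int -> K) (m : int) :
  ser_scale (exp_lin s) (laurent_at i0 v g : _ -> K^o) (m *: delta i0) =
  ser_scale (exp_z (s 0 i0)) (fun m => g m * v 0 i0 ^ m : K^o) m.
Proof.
pose t u := exp_lin s u *: (laurent_at i0 v g (m *: delta i0 - u) : K^o).
pose z (b : int) : 'rV[int]_n := b *: delta i0.
have zE b i : z b 0 i = if i == i0 then b else 0.
  by rewrite !mxE eqxx /=; case: eqP => _; rewrite ?mulr1 ?mulr0.
have zinj : set_inj [set: int] z.
  by move=> b b' _ _ /rowP/(_ i0); rewrite !zE eqxx.
rewrite /ser_scale -/(t _) -(fsbig_widen (z @` [set: int])) //; last first.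
  move=> u [_ uz] /=.
  have [i ii0 ui] : exists2 i, i != i0 & u 0 i != 0.
    apply: contrapT => H; apply: uz; exists (u 0 i0) => //.
    apply/rowP => i; rewrite zE; case: eqVneq => [-> //|ii0].
    by apply/esym/eqP/negPn/negP => ui; apply: H; exists i.
  have [u_lt|u_ge] := ltP (u 0 i) 0.
    by rewrite /t (exp_lin_neg _ u_lt) scale0r.
  rewrite /t (@laurent_at_neg _ _ _ _ i) ?scaler0 //.
  by rewrite !mxE (negPf ii0) andbF mulr0 sub0r oppr_lt0 lt_neqAle eq_sym ui.
rewrite fsbig_image //; apply: eq_fsum => j.
by rewrite /t /z -scalerBl exp_lin_axis laurent_axis.
Qed.

End MultivariateSeries.

(** * Laurent series in one variable *)

Section OneVariable.
Variables (K : fieldType).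
Hypothesis K0 : [pchar K] =i pred0.

Implicit Types (f g : int -> K) (c : K) (m : int).

(** Product with [exp (c z)]. *)
Definition texp c (g : int -> K) : int -> K :=
  ser_scale (exp_z c) (g : int -> K^o).

(** Laurent series whose exponents are at least [- B]. *)
Definition low (B : nat) (g : int -> K) := forall m, m < - B%:Z -> g m = 0.

Lemma exp_z_nat c (i : nat) : exp_z c i%:Z = c ^+ i / i`!%:R.
Proof. by []. Qed.

Lemma exp_z_neg c m : m < 0 -> exp_z c m = 0.
Proof. by rewrite /exp_z leNgt => ->. Qed.

Lemma exp_z0 m : exp_z (0 : K) m = (m == 0)%:R.
Proof.
case: m => [[|i]|i]; last by rewrite exp_z_neg.
  by rewrite exp_z_nat expr0 fact0 divr1.
by rewrite exp_z_nat expr0n mul0r.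
Qed.

Lemma exp_zS c m : (m + 1)%:~R * exp_z c (m + 1) = c * exp_z c m.
Proof.
case: m => [i|[|i]].
- have -> : i%:Z + 1 = i.+1%:Z by lia.
  rewrite !exp_z_nat factS natrM exprS invfM -pmulrn.
  set rhs := RHS; transitivity (i.+1%:R / i.+1%:R * rhs); first by rewrite /rhs; ring.
  by rewrite divff ?mul1r ?natr_neq0.
- by rewrite mul0r exp_z_neg ?mulr0.
- by rewrite !exp_z_neg ?mulr0 //; lia.
Qed.

Lemma texpE c B g m (N : nat) : low B g -> m + B%:Z < N%:Z ->
  texp c g m = \sum_(i < N) c ^+ i / i`!%:R * g (m - i%:Z).
Proof.
move=> gB mN; rewrite /texp /ser_scale (@fsum_seq _ _ [seq i%:Z | i <- iota 0 N]).
- by rewrite big_map -[N in iota 0 N]subn0 -/(index_iota 0 N) big_mkord.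
- by rewrite map_inj_uniq ?iota_uniq // => i j [].
- move=> j jN; have [j0|j0] := ltP j 0; first by rewrite exp_z_neg ?scale0r.
  rewrite gB ?scaler0 // ltNge; apply: contra jN => mj.
  apply/mapP; exists (absz j); last by rewrite gez0_abs.
  by rewrite mem_iota; move: mj mN; lia.
Qed.

Lemma texp_fin c B g m : low B g ->
  fin_supp (fun u : int => exp_z c u *: (g (m - u) : K^o)).
Proof.
move=> gB; apply: (@fin_supp_int _ (absz (m + B%:Z))) => u mu.
have [u0|u0] := ltP u 0; first by rewrite exp_z_neg ?scale0r.
by rewrite gB ?scaler0 //; move: mu; lia.
Qed.

Lemma texp_low c B g : low B g -> low B (texp c g).
Proof.
by move=> gB m mB; rewrite (texpE c gB (N := 0)) ?big_ord0 //; lia.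
Qed.

Lemma eq_texp c f g : f =1 g -> texp c f =1 texp c g.
Proof. by move=> /funext ->. Qed.

Lemma texpD c B f g m : low B f -> low B g ->
  texp c (fun m => f m + g m) m = texp c f m + texp c g m.
Proof.
move=> fB gB; rewrite /texp /ser_scale -(fsumD (texp_fin c m fB) (texp_fin c m gB)).
by apply: eq_fsum => u; exact: mulrDr.
Qed.

Lemma texpZ c b g m : texp c (fun m => b * g m) m = b * texp c g m.
Proof.
rewrite /texp /ser_scale mulr_fsumr; apply: eq_fsum => u; exact: mulrCA.
Qed.

Lemma texp_sum c B (I : Type) (r : seq I) (F : I -> int -> K) m :
  (forall x, low B (F x)) ->
  texp c (fun m => \sum_(x <- r) F x m) m = \sum_(x <- r) texp c (F x) m.
Proof.
move=> FB; elim: r m => [|x r IHr] m.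
  rewrite big_nil /texp /ser_scale fsum0 // => u.
  by rewrite big_nil scaler0.
rewrite big_cons -IHr -(texpD _ _ (FB x)).
  by apply: eq_texp => j; rewrite big_cons.
by move=> j jB; rewrite big1 // => y _; exact: FB.
Qed.

Lemma texp_unit c m : texp c (fun m => (m == 0)%:R) m = exp_z c m.
Proof.
rewrite /texp /ser_scale (fsum1 (i := m)) => [|u um].
  by rewrite subrr eqxx; exact: mulr1.
by rewrite subr_eq0 eq_sym (negPf um) scaler0.
Qed.

Lemma texp0 g m : texp 0 g m = g m.
Proof.
rewrite /texp /ser_scale (fsum1 (i := 0)) => [|u u0].
  by rewrite exp_z0 eqxx subr0 scale1r.
by rewrite exp_z0 (negPf u0) scale0r.
Qed.

Lemma natr_fact_neq0 i : i`!%:R != 0 :> K.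
Proof. by have := fact_gt0 i; case: (i`!) => // j _; exact: natr_neq0. Qed.

Lemma exp_coefD a b s : (a + b) ^+ s / s`!%:R =
  \sum_(i < s.+1) (a ^+ i / i`!%:R) * (b ^+ (s - i) / (s - i)`!%:R) :> K.
Proof.
rewrite addrC exprDn mulr_suml; apply: eq_bigr => i _.
have is_ : (i <= s)%N by rewrite -ltnS.
have := bin_fact is_ => /(congr1 (fun n => n%:R : K)); rewrite !natrM => <-.
have bin0 : 'C(s, i)%:R != 0 :> K.
  have : (0 < 'C(s, i))%N by rewrite bin_gt0.
  by case: 'C(s, i) => // j _; exact: natr_neq0.
rewrite -mulr_natr; have := natr_fact_neq0 i; have := natr_fact_neq0 (s - i).
move=> f1 f2; field; by rewrite f1 f2 bin0.
Qed.

Lemma texp_comp a b B g m : low B g -> texp a (texp b g) m = texp (a + b) g m.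
Proof.
move=> gB; pose N := (absz (m + B%:Z)).+1.
have mN : m + B%:Z < N%:Z by rewrite /N; lia.
rewrite (texpE a (texp_low b gB) mN) (texpE _ gB mN).
under [RHS]eq_bigr do rewrite exp_coefD mulr_suml.
pose F (s i : nat) := a ^+ i / i`!%:R * (b ^+ (s - i) / (s - i)`!%:R) * g (m - s%:Z).
rewrite [RHS](_ : _ = \sum_(0 <= s < N) \sum_(0 <= i < N | (i <= s)%N) F s i).
  rewrite (exchange_big_dep_nat predT) //= big_mkord; apply: eq_bigr => i _.
  have iN : (i <= N)%N by exact: ltnW.
  rewrite (texpE b gB (N := N - i)); last by move: iN mN; lia.
  rewrite (big_cat_nat (n := i)) //= [X in _ = X + _]big_nat_cond.
  rewrite [X in _ = X + _]big_pred0; last first.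
    by move=> s; apply/negbTE; lia.
  rewrite add0r -[X in \sum_(X <= _ < N | _) _]add0n big_addn big_mkord mulr_sumr.
  under [RHS]eq_bigl do rewrite leq_addl.
  apply: eq_bigr => j _; rewrite /F addnK !mulrA; congr (_ * g _); lia.
rewrite big_mkord; apply: eq_bigr => s _.
by rewrite -(big_mkord predT (F s)) (big_nat_widen 0 s.+1 N).
Qed.

Lemma texp_deriv c B g m : low B g ->
  deriv_z (texp c g) m = c * texp c g m + texp c (deriv_z g) m.
Proof.
move=> gB.
have gB1 : low B.+1 (deriv_z g).
  by move=> j jB; rewrite /deriv_z gB ?mulr0 //; lia.
pose t1 (u : int) : K^o := (u%:~R * exp_z c u) * g (m + 1 - u).
have t1fin : fin_supp t1.
  apply: fin_suppW (texp_fin c (m + 1) gB) => u; rewrite /t1 -mulrA.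
  by rewrite -[_ *: _]/(_ * _) => ->; rewrite mulr0.
have -> : c * texp c g m = \sum_(u \in [set: int]) t1 u.
  have subK : cancel (fun u : int => u + 1) (fun u => u - 1) by move=> u; rewrite addrK.
  rewrite (fsum_reindex _ subK (fun u => subrK 1 u)) /texp /ser_scale mulr_fsumr.
  apply: eq_fsum => u; rewrite /t1 exp_zS -mulrA; congr (_ * (_ * g _)).
  by rewrite opprD addrACA subrr addr0.
rewrite /deriv_z {1}/texp {1}/ser_scale mulr_fsumr /texp /ser_scale.
rewrite -(fsumD t1fin (texp_fin c m gB1)); apply: eq_fsum => u.
rewrite /t1 /GRing.scale /= /deriv_z.
have -> : m + 1 - u = m - u + 1 by ring.
have -> : (m + 1)%:~R = u%:~R + (m - u + 1)%:~R :> K.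
  by rewrite -intrD; congr (_%:~R); ring.
ring.
Qed.

(** The involution [z -> - z]. *)
Definition flip g : int -> K := fun m => g m * (-1) ^ m.

Lemma signz_add m n : (-1) ^ (m + n) = (-1) ^ m * (-1) ^ n :> K.
Proof. by rewrite expfzDr // oppr_eq0 oner_eq0. Qed.

Lemma flip_texp c g m : flip (texp c g) m = texp (- c) (flip g) m.
Proof.
rewrite /flip /texp /ser_scale mulr_fsuml; apply: eq_fsum => u.
have -> : m = u + (m - u) by ring.
rewrite signz_add addrAC subrr add0r /GRing.scale /=.
suff -> : exp_z (- c) u = exp_z c u * (-1) ^ u by ring.
have [u0|u0] := ltP u 0; first by rewrite !exp_z_neg ?mul0r.
case: u u0 => // i _; rewrite !exp_z_nat -exprnP exprNn.
by rewrite -mulrA; exact: mulrC.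
Qed.

Lemma flip_low B g : low B g -> low B (flip g).
Proof. by move=> gB m mB; rewrite /flip gB ?mul0r. Qed.

(** A series equal to its product with [e^z] is zero, as seen on its term of
    lowest degree. *)
Lemma texp1_fixed B g : low B g -> (forall m, texp 1 g m = g m) ->
  forall m, g m = 0.
Proof.
move=> gB g1 m; have [n] := ubnP (absz (m + B%:Z)).
elim: n m => // n IHn m mn; have [mB|mB] := ltP m (- B%:Z); first exact: gB.
have N1 : m + 1 + B%:Z < (absz (m + B%:Z)).+2%:Z by lia.
have := g1 (m + 1); rewrite (texpE 1 gB N1) 2!big_ord_recl big1 => [|i _].
  move=> E; have {E} : 1 ^+ 0 / 0`!%:R * g (m + 1 - 0%:Z) +
      (1 ^+ 1 / 1`!%:R * g (m + 1 - 1%:Z) + 0) = g (m + 1) := E.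
  rewrite !expr1n fact0 (_ : 1`! = 1%N) // divr1 !mul1r subr0 addr0 addrK.
  by move/(canRL (addKr _)); rewrite addNr.
have [mi|mi] := ltP (m + 1 - (lift ord0 (lift ord0 i))%:Z) (- B%:Z).
  by rewrite gB ?mulr0.
rewrite IHn ?mulr0 //; move: mn mi; rewrite !lift0 /=; lia.
Qed.

Local Notation inv := (@inv_one_sub_exp K : int -> K).

Lemma inv_low : low 1 inv.
Proof. by move=> m m1; rewrite /inv_one_sub_exp leNgt m1. Qed.

(** [inv] is [1 / (1 - e^(- z))]: multiplying it by [1 - e^(- z)] gives [1]. *)
Lemma inv_texpN1 m : inv m - texp (-1) inv m = (m == 0)%:R.
Proof.
have [m1|m1] := ltP m (-1).
  rewrite (texpE _ inv_low (N := 0)) ?big_ord0 ?inv_low ?subr0 //; last lia.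
  by case: eqP => // m0; move: m1; lia.
pose N := absz (m + 1).
have mN : m + 1%N%:Z < N.+1%:Z by rewrite /N; lia.
rewrite (texpE _ inv_low mN) big_ord_recl.
rewrite -[X in _ - (X + _)]/((-1) ^+ 0 / 0`!%:R * inv (m - 0%:Z)).
rewrite expr0 fact0 divr1 mul1r subr0.
rewrite opprD addrA subrr add0r.
case E : N => [|n].
  by rewrite big_ord0 oppr0; case: eqP => // m0; move: E; rewrite /N; lia.
have mE : m = n%:Z by move: E; rewrite /N; lia.
pose q i : K := (-1) ^+ i / (i.+1`!)%:R.
have q0 : q 0%N != 0 by rewrite /q expr0 (_ : 1`! = 1%N) // divr1 oner_eq0.
transitivity (\sum_(j < n.+1) q (n - j)%N * ps_inv q j); last first.
  by rewrite (ps_invP _ q0) mE.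
rewrite (reindex_inj rev_ord_inj) -sumrN /=; apply: eq_bigr => i _.
have in_ : (i <= n)%N by rewrite -ltnS.
have -> : m - (lift ord0 (rev_ord i))%:Z = i%:Z - 1.
  by rewrite lift0 /= subSS mE; lia.
rewrite /inv_one_sub_exp subrK ifT; last by lia.
rewrite /bump add1n subSS -mulNr; congr (_ * _).
by rewrite exprS mulN1r mulNr opprK.
Qed.

Lemma texp_inv c m : texp c inv m - texp (c - 1) inv m = exp_z c m.
Proof.
have lo : low 1 (fun m => - 1 * texp (-1) inv m).
  by move=> j j1; rewrite (texp_low (-1) inv_low) ?mulr0.
have E j : inv j + - 1 * texp (-1) inv j = (j == 0)%:R.
  by rewrite mulN1r inv_texpN1.
rewrite -texp_unit -(eq_texp c E) (texpD c m inv_low lo) texpZ mulN1r.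
by rewrite (texp_comp c (-1) m inv_low).
Qed.

(** [1 / (1 - e^z) = - e^(- z) / (1 - e^(- z))]; the difference of the two sides
    is fixed by the multiplication by [e^z]. *)
Lemma flip_inv m : flip inv m = - texp (-1) inv m.
Proof.
pose g m := flip inv m + texp (-1) inv m.
have lo1 := flip_low inv_low; have lo2 := texp_low (-1) inv_low.
suff : g m = 0 by move/eqP; rewrite addr_eq0 => /eqP.
apply: (@texp1_fixed 1) => [j j1|j]; first by rewrite /g lo1 ?lo2 ?addr0.
rewrite (texpD _ _ lo1 lo2) (texp_comp _ _ _ inv_low) addrN texp0 /g.
have -> : texp 1 (flip inv) j = flip inv j - (j == 0)%:R.
  rewrite -[1 in LHS]opprK -flip_texp {1}/flip.
  have -> : texp (-1) inv j = inv j - (j == 0)%:R by rewrite -inv_texpN1; ring.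
  rewrite mulrBl; congr (_ - _); case: eqP => [->|_]; last by rewrite mul0r.
  by rewrite expr0z mulr1.
by rewrite -[in RHS](subrK (inv j) (texp (-1) inv j)) -opprB inv_texpN1; ring.
Qed.

End OneVariable.

(** * The generating series of the eigenspace dimensions *)

Section DimSeries.
Variables (K : fieldType) (p : nat) (D : int -> K).
Hypothesis K0 : [pchar K] =i pred0.
Hypothesis p_gt0 : (0 < p)%N.
Hypothesis D_period : forall M N, (p %| M - N)%Z -> D M = D N.
Hypothesis D_opp : forall M, D (- M) = D M.

Local Notation inv := (@inv_one_sub_exp K : int -> K).

(** [\sum_k D k e^(- k z / p) / (1 - e^(- z))]; formally this is
    [\sum_(M >= 0) D M e^(- M z / p)]. *)
Definition dimser (m : int) : K :=
  \sum_(k < p) D k * texp (- (k%:R / p%:R)) inv m.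

Let pK : p%:R != 0 :> K.
Proof. by case: p p_gt0 => // n _; exact: natr_neq0. Qed.

Lemma dimser_low : low 1 dimser.
Proof.
by move=> m m1; rewrite /dimser big1 // => k _; rewrite (texp_low _ (inv_low K)) ?mulr0.
Qed.

Lemma texp_dimser c m : texp c dimser m =
  \sum_(k < p) D k * texp (c - k%:R / p%:R) inv m.
Proof.
rewrite /dimser (texp_sum c _ m (B := 1)) => [|k j j1].
  by apply: eq_bigr => k _; rewrite texpZ (texp_comp _ _ _ _ (inv_low K)).
by rewrite (texp_low _ (inv_low K)) ?mulr0.
Qed.

Lemma texp_dimser_step c m : texp c dimser m - texp (c - 1) dimser m =
  \sum_(k < p) D k * exp_z (c - k%:R / p%:R) m.
Proof.
rewrite !texp_dimser -sumrB; apply: eq_bigr => k _.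
by rewrite -mulrBr -addrAC texp_inv.
Qed.

(** [f (- z) = - f z + D 0], by exchanging the terms [k] and [p - k]. *)
Lemma flip_dimser m : flip dimser m = - dimser m + D 0 * (m == 0)%:R.
Proof.
have -> : flip dimser m = - \sum_(k < p) D k * texp (k%:R / p%:R - 1) inv m.
  rewrite /flip {1}/dimser mulr_suml -sumrN; apply: eq_bigr => k _.
  rewrite -mulrA -[RHS]mulrN; congr (_ * _).
  rewrite -[LHS]/(flip (texp _ inv) m) flip_texp opprK.
  have -> : texp (k%:R / p%:R) (flip inv) m =
      texp (k%:R / p%:R) (fun m => - 1 * texp (-1) inv m) m.
    by apply: eq_texp => j; rewrite flip_inv // mulN1r.
  by rewrite texpZ mulN1r (texp_comp _ _ _ _ (inv_low K)).
rewrite /dimser; case: p p_gt0 pK D_period => // n _ nK Dper.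
rewrite big_ord_recl /= [in RHS]big_ord_recl /= mul0r sub0r oppr0 texp0 //.
have -> : texp (-1) inv m = inv m - (m == 0)%:R by rewrite -inv_texpN1; ring.
suff -> : \sum_(i < n) D (bump 0 i) * texp ((bump 0 i)%:R / n.+1%:R - 1) inv m =
  \sum_(i < n) D (bump 0 i) * texp (- ((bump 0 i)%:R / n.+1%:R)) inv m by ring.
rewrite (reindex_inj rev_ord_inj); apply: eq_bigr => i _ /=.
have E : (bump 0 (n - i.+1) + bump 0 i = n.+1)%N.
  by rewrite /bump !add1n; have := ltn_ord i; lia.
congr (_ * texp _ _ _).
  by rewrite -[LHS]D_opp; apply: Dper; apply/dvdzP; exists (-1); move: E; lia.
have -> : (bump 0 (n - i.+1))%:R = n.+1%:R - (bump 0 i)%:R :> K.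
  by rewrite -[X in X%:R - _]E natrD addrK.
by rewrite mulrBl divff //; ring.
Qed.

Lemma deriv_dimser_even m : deriv_z dimser m * (-1) ^ m = deriv_z dimser m.
Proof.
rewrite /deriv_z; have [->|m1] := eqVneq (m + 1) 0; first by rewrite !mul0r.
have := flip_dimser (m + 1); rewrite (negPf m1) mulr0 addr0 /flip signz_add //.
rewrite expr1z mulrN1 mulrN => /oppr_inj E.
by rewrite -mulrA E.
Qed.

(** [e^(k z) f - f] for [f = \sum_(M >= 0) D M e^(- M z / p)]. *)
Lemma texp_dimser_int (k : int) m :
  texp k%:~R dimser m - dimser m = \sum_(M \in [set: int])
    D M * ((0 <= M + k * p%:Z)%R%:R - (0 <= M)%R%:R) * exp_z (- (M%:~R / p%:R)) m.
Proof.
pose G (k : int) (M : int) : K :=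
  D M * ((0 <= M + k * p%:Z)%R%:R - (0 <= M)%R%:R) * exp_z (- (M%:~R / p%:R)) m.
have Gfin j : fin_supp (G j).
  apply: (@fin_supp_int _ (absz (j * p%:Z))) => M MB; rewrite /G.
  have -> : (0 <= M + j * p%:Z) = (0 <= M) by move: MB; lia.
  by rewrite subrr mulr0 mul0r.
have step j : \sum_(M \in [set: int]) G (j + 1) M =
    \sum_(M \in [set: int]) G j M + (texp (j + 1)%:~R dimser m - texp j%:~R dimser m).
  have jE : j%:~R = (j + 1)%:~R - 1 :> K by rewrite intrD; exact/esym/addrK.
  rewrite [in texp j%:~R _ _]jE.
  rewrite (texp_dimser_step (j + 1)%:~R m).
  apply: (addIr (- \sum_(M \in [set: int]) G j M)); rewrite [RHS]addrAC subrr add0r.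
  rewrite -(fsumB (Gfin (j + 1)) (Gfin j)).
  pose h (i : int) := i - (j + 1) * p%:Z.
  have hK : cancel h (fun M => M + (j + 1) * p%:Z) by move=> i; rewrite /h subrK.
  have hK' : cancel (fun M => M + (j + 1) * p%:Z) h by move=> i; rewrite /h addrK.
  rewrite (fsum_reindex _ hK hK') (@fsum_seq _ _ [seq i%:Z | i <- iota 0 p]).
  - rewrite big_map -[p in iota 0 p]subn0 -/(index_iota 0 p) big_mkord.
    apply: eq_bigr => i _; rewrite /G /h subrK.
    have -> : (0 <= i%:Z - (j + 1) * p%:Z + j * p%:Z) = false.
      by have := ltn_ord i; lia.
    have -> : D (i%:Z - (j + 1) * p%:Z) = D i.
      apply: D_period; apply/dvdzP; exists (- (j + 1)); ring.
    have -> : - ((i%:Z - (j + 1) * p%:Z)%:~R / p%:R) = (j + 1)%:~R - i%:R / p%:R :> K.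
      by rewrite rmorphB rmorphM /= -!pmulrn; field.
    by rewrite /=; ring.
  - by rewrite map_inj_uniq ?iota_uniq // => i i' [].
  - move=> i ip; rewrite /G /h subrK.
    have -> : (0 <= i - (j + 1) * p%:Z + j * p%:Z) = (0 <= i).
      apply/idP/idP => [|i0]; first by lia.
      suff : p%:Z <= i by lia.
      rewrite leNgt; apply: contra ip => ip; apply/mapP; exists (absz i).
        by rewrite mem_iota; lia.
      by rewrite gez0_abs.
    by ring.
have G0 : \sum_(M \in [set: int]) G 0 M = 0.
  by apply: fsum0 => M; rewrite /G mul0r addr0 subrr mulr0 mul0r.
have base : \sum_(M \in [set: int]) G 0 M = texp 0%:~R dimser m - dimser m.
  by rewrite G0 texp0 // subrr.
suff H (n : nat) : \sum_(M \in [set: int]) G n%:Z M = texp n%:Z%:~R dimser m - dimser m /\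
   \sum_(M \in [set: int]) G (- n%:Z) M = texp (- n%:Z)%:~R dimser m - dimser m.
  by apply/esym; case: k => n; [case: (H n) | rewrite NegzE; case: (H n.+1)].
elim: n => [|n [IH1 IH2]]; first by rewrite oppr0.
split.
  have -> : n.+1%:Z = n%:Z + 1 by lia.
  by rewrite step IH1; ring.
have := step (- n.+1%:Z); have -> : - n.+1%:Z + 1 = - n%:Z by lia.
pose x j := texp j%:~R dimser m.
by rewrite IH2 => E; apply: (addIr (x (- n%:Z) - x (- n.+1%:Z))); rewrite -E /x; ring.
Qed.

(** The restriction of [scalar_terms] below to one axis. As [f'] is even, the
    left-hand side is [(d^2/dz^2 - k d/dz) (e^(k z) f - f)], to which
    [texp_dimser_int] applies. The cutoffs there have weak inequalities; this is
    immaterial, since the terms [M = 0] and [M = - N1] have weight zero. *)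
Lemma dimser_anomaly (k m : int) (N1 := k * p%:Z) :
  (m + 1)%:~R * texp k%:~R (fun m => deriv_z dimser m * (-1) ^ m) (m + 1) +
  k%:~R * deriv_z dimser m - deriv_z (deriv_z dimser) m =
  \sum_(M \in [set: int]) (M%:~R / p%:R) * ((- N1 - M)%:~R / p%:R) * D M *
    ((0 < M)%R%:R - (0 < M + N1)%R%:R) * exp_z (- (M%:~R / p%:R)) m.
Proof.
set f := dimser; pose g m := texp k%:~R f m - f m.
have -> : texp k%:~R (fun m => deriv_z f m * (-1) ^ m) (m + 1) =
    texp k%:~R (deriv_z f) (m + 1).
  by apply: eq_texp => j; exact: deriv_dimser_even.
have -> : texp k%:~R (deriv_z f) (m + 1) =
    deriv_z (texp k%:~R f) (m + 1) - k%:~R * texp k%:~R f (m + 1).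
  by rewrite (texp_deriv K0 k%:~R (m + 1) dimser_low) addrAC subrr add0r.
transitivity ((m + 1)%:~R * ((m + 2)%:~R * g (m + 2)) -
    k%:~R * ((m + 1)%:~R * g (m + 1))).
  rewrite /deriv_z /g (_ : m + 1 + 1 = m + 2); [ring | lia].
have bE j : g j = \sum_(M \in [set: int])
    D M * ((0 <= M + N1)%R%:R - (0 <= M)%R%:R) * exp_z (- (M%:~R / p%:R)) j.
  exact: texp_dimser_int.
rewrite !bE.
pose b (M : int) : K := D M * ((0 <= M + N1)%R%:R - (0 <= M)%R%:R).
have bfin : fin_supp b.
  apply: (@fin_supp_int _ (absz N1)) => M MB; rewrite /b.
  have -> : (0 <= M + N1) = (0 <= M) by move: MB; lia.
  by rewrite subrr mulr0.
rewrite !mulr_fsumr -fsumB; first last.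
- by apply: fin_suppW bfin => M; rewrite /b => ->; rewrite mul0r !mulr0.
- by apply: fin_suppW bfin => M; rewrite /b => ->; rewrite mul0r !mulr0.
apply: eq_fsum => M; set c := - (M%:~R / p%:R).
have E2 : (m + 2)%:~R * exp_z c (m + 2) = c * exp_z c (m + 1).
  by rewrite -exp_zS // (_ : m + 1 + 1 = m + 2) //; lia.
have E1 := exp_zS K0 c m.
rewrite -/(b M).
transitivity (b M * ((m + 1)%:~R * ((m + 2)%:~R * exp_z c (m + 2)) -
   k%:~R * ((m + 1)%:~R * exp_z c (m + 1)))); first ring.
rewrite E2 mulrCA E1.
have -> : b M * (c * (c * exp_z c m) - k%:~R * (c * exp_z c m)) =
  (c * (c - k%:~R)) * b M * exp_z c m by ring.
congr (_ * _).
have -> : c * (c - k%:~R) = M%:~R / p%:R * ((M + N1)%:~R / p%:R).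
  by rewrite /c /N1 rmorphD rmorphM /= -pmulrn; field.
rewrite /b; have -> : - N1 - M = - (M + N1) by ring.
rewrite rmorphN /=; have [->|M0] := eqVneq M 0; first by rewrite !mul0r.
have [->|MN0] := eqVneq (M + N1) 0; first by rewrite mulr0z oppr0 !(mul0r, mulr0).
rewrite !lt_neqAle !(eq_sym 0) M0 MN0 /=; ring.
Qed.

End DimSeries.

(** * The scalar terms *)

Section ScalarTerms.
Variables (K : fieldType) (p : nat) (D : int -> K).
Hypothesis K0 : [pchar K] =i pred0.
Hypothesis p_gt0 : (0 < p)%N.
Hypothesis D_period : forall M N, (p %| M - N)%Z -> D M = D N.
Hypothesis D_opp : forall M, D (- M) = D M.

Local Notation y i := (delta_mx 0 i : 'rV[K]_4).
Local Notation delta i := (delta_mx 0 i : 'rV[int]_4).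
Local Notation f' := (deriv_z (dimser p D)).

Let pK : p%:R != 0 :> K.
Proof. by case: p p_gt0 => // n _; exact: natr_neq0. Qed.

Let f'_low : forall m : int, m < - 2%:Z -> f' m = 0.
Proof.
by move=> m m2; rewrite /deriv_z dimser_low ?mulr0 //; move: m2; lia.
Qed.

(** All terms are transported along the [y_0]-axis with the same coefficients [c]
    and [w] below, so that the identity need only be checked on this axis, where
    it is [dimser_anomaly]. *)
Lemma scalar_terms (k : int) (i3 i4 : 'I_4) (e : 'rV[int]_4) (N1 := k * p%:Z) :
  i3 != 0 -> i3 != 1 -> i4 != 0 -> i4 != 1 ->
  deriv_y 0 (ser_scale (exp_lin (k%:~R *: (y 0 - y i3)))
    (laurent_at 0 (- y 0 + y 1 + y i3 - y i4) f' : _ -> K^o)) e +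
  deriv_y 1 (ser_scale (exp_lin (k%:~R *: (y 1 - y i4)))
    (laurent_at 0 (y 0 - y 1 + y i4 - y i3) f' : _ -> K^o)) e =
  \sum_(M \in [set: int]) (M%:~R / p%:R) * ((- N1 - M)%:~R / p%:R) * D M *
    ((0 < M)%R%:R - (0 < M + N1)%R%:R) *
    exp_lin (- (M%:~R / p%:R) *: (y 0 - y i3) +
             ((N1 + M)%:~R / p%:R) *: (y 1 - y i4)) e.
Proof.
move=> i30 i31 i40 i41.
pose b (M : int) : K := (M%:~R / p%:R) * ((- N1 - M)%:~R / p%:R) * D M *
    ((0 < M)%R%:R - (0 < M + N1)%R%:R).
have /fin_supp_uniq[r ur br] : fin_supp b.
  apply: (@fin_supp_int _ (absz N1)) => M MB; rewrite /b.
  have -> : (0 < M + N1) = (0 < M) by move: MB; lia.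
  by rewrite subrr mulr0.
pose s M := - (M%:~R / p%:R) *: (y 0 - y i3) + ((N1 + M)%:~R / p%:R) *: (y 1 - y i4).
pose sA := k%:~R *: (y 0 - y i3); pose sD := k%:~R *: (y 1 - y i4).
pose vA := - y 0 + y 1 + y i3 - y i4; pose vD := y 0 - y 1 + y i4 - y i3.
pose TA := ser_scale (exp_lin sA) (laurent_at 0 vA f' : _ -> K^o).
pose TD := ser_scale (exp_lin sD) (laurent_at 0 vD f' : _ -> K^o).
have sumE (G : int -> K) :
    \sum_(M \in [set: int]) b M * G M = \sum_(M <- r) b M * G M.
  by apply: fsum_seq => // M /br ->; rewrite mul0r.
rewrite -/sA -/sD -/vA -/vD -/TA -/TD (sumE (fun M => exp_lin (s M) e)).
pose F e : K^o := deriv_y 0 TA e + deriv_y 1 TD e +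
  -1 * \sum_(M <- r) b M * exp_lin (s M) e.
suff : F e = 0.
  by rewrite /F mulN1r => /eqP; rewrite subr_eq0 => /eqP.
have dE (i j : 'I_4) : (y j) 0 i = (i == j)%:R by rewrite mxE eqxx.
have [n30 n31] : (0 == i3) = false /\ (1 == i3) = false.
  by rewrite ![_ == i3]eq_sym (negPf i30) (negPf i31).
have [n40 n41] : (0 == i4) = false /\ (1 == i4) = false.
  by rewrite ![_ == i4]eq_sym (negPf i40) (negPf i41).
have vA0 : vA 0 0 = -1 by rewrite !mxE /= n30 n40 /=; ring.
have vD0 : vD 0 0 = 1 by rewrite !mxE /= n30 n40 /=; ring.
have sA0 : sA 0 0 = k%:~R by rewrite !mxE /= n30 /=; ring.
have sD0 : sD 0 0 = 0 by rewrite !mxE /= n40 /=; ring.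
have s0 M : s M 0 0 = - (M%:~R / p%:R) by rewrite !mxE /= n30 n40 /=; ring.
have vD1 : vD 0 1 = -1 by rewrite !mxE /= n31 n41 /=; ring.
have sD1 : sD 0 1 = k%:~R by rewrite !mxE /= n41 /=; ring.
pose c i : K := k%:~R * ((i == 1)%:R - (i == i4)%:R).
pose w i : K := - (i == 1)%:R - (i == i3)%:R + (i == i4)%:R.
have FT : transported 0 c w F.
  apply: transportedD; first apply: transportedD.
  - apply: transported_deriv; apply: (transported_laurent K0 _ f'_low).
    + by rewrite vA0 oppr_eq0 oner_eq0.
    + by move=> i i0; rewrite vA0 /w !mxE /= (negPf i0) /=; ring.
    + by move=> i i0; rewrite sA0 /w /c !mxE /= (negPf i0) /=; ring.
  - apply: transported_deriv; apply: (transported_laurent K0 _ f'_low).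
    + by rewrite vD0 oner_eq0.
    + by move=> i i0; rewrite vD0 /w !mxE /= (negPf i0) /=; ring.
    + by move=> i i0; rewrite sD0 /w /c !mxE /=; ring.
  - apply: transportedZ; apply: transported_sum => M; apply: transportedZ.
    apply: transported_exp => // i i0; rewrite s0 /w /c !mxE /= (negPf i0) /=.
    by rewrite /N1 rmorphD rmorphM /= -pmulrn; field.
apply: (transported_eq0 K0 FT) => m.
have mE : (m *: delta 0) 0 0 = m by rewrite !mxE mulr1.
have mS : m *: delta 0 + delta 0 = (m + 1) *: delta 0 by rewrite scalerDl scale1r.
have TDE (g : int -> K) : ser_scale (exp_lin sD) (laurent_at 0 vD g : _ -> K^o)
    (m *: delta 0) = g m.
  rewrite conv_laurent_axis sD0 vD0 -[LHS]/(texp 0 (fun m => g m * 1 ^ m) m).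
  by rewrite texp0 exp1rz mulr1.
have TDd : deriv_y 1 TD (m *: delta 0) = k%:~R * f' m - deriv_z f' m.
  rewrite (deriv_conv_laurent K0 (i0 := 0) 1 sD (m *: delta 0) _ f'_low).
    by rewrite sD1 vD1 !TDE mulN1r.
  by rewrite vD0 oner_eq0.
have TAd : deriv_y 0 TA (m *: delta 0) =
    (m + 1)%:~R * texp k%:~R (fun m => f' m * (-1) ^ m) (m + 1).
  by rewrite /deriv_y mE mS /TA conv_laurent_axis sA0 vA0.
rewrite /F TDd TAd.
rewrite mulN1r.
have -> : \sum_(M <- r) b M * exp_lin (s M) (m *: delta 0) =
    \sum_(M <- r) b M * exp_z (- (M%:~R / p%:R)) m.
  by apply: eq_bigr => M _; rewrite exp_lin_axis s0.
rewrite -sumE -(dimser_anomaly K0 p_gt0 D_period D_opp).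
by rewrite addrA subrr.
Qed.

End ScalarTerms.

Section SplitVariables.
Variables (K : fieldType) (n : nat).
Implicit Types (A : pred 'I_n) (e : 'rV[int]_n) (l : 'rV[K]_n).

(** The exponents of the variables indexed by [A], the others being zero. *)
Definition mask A e : 'rV[int]_n := \row_i (if A i then e 0 i else 0).

Lemma maskC A e : e - mask A e = mask (predC A) e.
Proof. by apply/rowP => i; rewrite !mxE /=; case: (A i); rewrite ?subrr ?subr0. Qed.

(** The exponential of a sum of linear forms in disjoint sets of variables. *)
Lemma exp_lin_split A l1 l2 e :
  (forall i, ~~ A i -> l1 0 i = 0) -> (forall i, A i -> l2 0 i = 0) ->
  exp_lin l1 (mask A e) * exp_lin l2 (mask (predC A) e) = exp_lin (l1 + l2) e.
Proof.
move=> l10 l20; rewrite /exp_lin.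
have -> : [forall i, 0 <= e 0 i] = [forall i, 0 <= mask A e 0 i] &&
    [forall i, 0 <= mask (predC A) e 0 i].
  apply/forallP/andP => [e0|[/forallP e1 /forallP e2] i].
    by split; apply/forallP => i; rewrite mxE /=; case: (A i) => //=.
  by have := e1 i; have := e2 i; rewrite !mxE /=; case: (A i).
case: ifP => _; last by rewrite mul0r.
case: ifP => _; last by rewrite mulr0.
rewrite -big_split /=; apply: eq_bigr => i _; rewrite !mxE /=.
case Ai : (A i) => /=.
  by rewrite l20 // addr0 expr0 fact0 divr1 mulr1.
by rewrite l10 ?Ai // add0r expr0 fact0 divr1 mul1r.
Qed.

Lemma exp_lin_supp l e i : l 0 i = 0 -> e 0 i != 0 -> exp_lin l e = 0.
Proof.
move=> li ei; rewrite /exp_lin; case: ifP => // _.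
rewrite (bigD1 i) //= li expr0n absz_eq0 (negPf ei).
by rewrite !mul0r.
Qed.

Lemma laurent_supp i0 l (g : int -> K) e i : i != i0 -> l 0 i = 0 ->
  e 0 i != 0 -> laurent_at i0 l g e = 0.
Proof.
move=> ii0 li ei; rewrite laurent_atE /lin_pow; case: ifP; rewrite ?mulr0 // => _.
rewrite [X in _ * (_ * X)](bigD1 i) //= li expr0n absz_eq0 (negPf ei).
by rewrite !mul0r !mulr0.
Qed.

End SplitVariables.

(** * The bracket formula over a Heisenberg module *)

Section Bracket.
Variables (K : fieldType) (h : lmodType K) (form : {symmetric h}) (p d : nat).
Variables (V : lmodType K) (a : h -> int -> V -> V) (P : int -> h -> h).
Variables (alpha : 'I_d -> h) (D : int -> K).
Hypothesis K0 : [pchar K] =i pred0.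
Hypothesis p_gt0 : (0 < p)%N.
Hypothesis aH : twisted_heisenberg form p a P alpha D.

Local Notation nquad := (nquad a alpha).
Local Notation wquad := (wquad a alpha).
Local Notation f' := (deriv_z (dimser p D)).
Local Notation axis j := (delta_mx 0 j : 'rV[int]_2).

Implicit Types (b c : 'rV[K]_4) (e : 'rV[int]_4) (X : 'rV[int]_2) (M N : int).

(** The linear form in the exponential of the product of the modes [M] and
    [- N - M] in [alpha<e^b x> alpha<e^c x>]. *)
Definition expo_form b c N M : 'rV[K]_4 :=
  - (M%:~R / p%:R) *: b - ((- N - M)%:~R / p%:R) *: c.

(** The coefficient of [x^N y^e] in [1/2 \sum_q :alpha_q<e^b x> alpha_q<e^c x>:]. *)
Definition lquad b c N e : V -> V :=
  wquad (fun M => exp_lin (expo_form b c N M) e) N.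

(** The series [L^(b, c)<x_j>]. *)
Definition lbar (j : 'I_2) (i0 : 'I_4) b c : expo -> V -> V :=
  fun Xe =>
    (if Xe.1 == Xe.1 0 j *: delta_mx 0 j then lquad b c (Xe.1 0 j) Xe.2 else 0)
    - (if Xe.1 == 0 then
         (2^-1 * laurent_at i0 (b - c) f' Xe.2) *: id
       else 0).

(** The scalar subtracted from the quadratic in [lbar]. *)
Definition lscal (i0 : 'I_4) b c X e : K :=
  if X == 0 then 2^-1 * laurent_at i0 (b - c) f' e else 0.

Lemma lbarE j i0 b c X e v : X == X 0 j *: delta_mx 0 j ->
  lbar j i0 b c (X, e) v = lquad b c (X 0 j) e v - lscal i0 b c X e *: v.
Proof.
move=> Xj; rewrite /lbar /lscal /= Xj; case: ifP => _ //.
by rewrite scale0r.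
Qed.

Lemma lbar_axis0 j i0 b c X e : X != X 0 j *: delta_mx 0 j ->
  lbar j i0 b c (X, e) = 0.
Proof.
move=> Xj; rewrite /lbar /= (negPf Xj) ifF ?subr0 //.
apply: contraNF Xj => /eqP ->.
by rewrite mxE scale0r.
Qed.

Lemma lquad_eq0 b c N e : (forall M, exp_lin (expo_form b c N M) e = 0) ->
  lquad b c N e = 0.
Proof.
move=> E0; apply/funext => v; rewrite /lquad /wquad fsum0 ?scaler0 // => M.
by rewrite E0 scale0r.
Qed.

Lemma lbar_supp j i0 b c X e i : i != i0 -> b 0 i = 0 -> c 0 i = 0 ->
  e 0 i != 0 -> lbar j i0 b c (X, e) = 0.
Proof.
move=> ii0 bi ci ei; rewrite /lbar /=.
rewrite lquad_eq0 => [|M]; last first.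
  by rewrite (exp_lin_supp (i := i)) // !mxE bi ci !mulr0 subrr.
rewrite (laurent_supp f' ii0 _ ei) ?mxE ?bi ?ci ?subrr //.
by rewrite mulr0 scale0r !if_same subrr.
Qed.

Lemma lquad_lin b c N e t u v :
  lquad b c N e (t *: u + v) = t *: lquad b c N e u + lquad b c N e v.
Proof. exact: (wquad_lin aH). Qed.

Lemma lbar_vec0 j i0 b c Xe : lbar j i0 b c Xe 0 = 0.
Proof.
case: Xe => X e; have [Xj|Xj] := boolP (X == X 0 j *: delta_mx 0 j).
  by rewrite lbarE // (lin0 (lquad_lin _ _ _ _)) scaler0 subrr.
by rewrite lbar_axis0.
Qed.

Lemma ser_comp_single (E : zmodType) (F G : E -> V -> V) (u z : E) :
  (forall w, F w 0 = 0) -> (forall w, w != u -> F w = 0 \/ G (z - w) = 0) ->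
  ser_comp F G z = F u \o G (z - u).
Proof.
by move=> F0 FG; apply: fsum1 => w /FG[] ->; apply/funext => v //=.
Qed.

(** Two series [lbar] in disjoint sets of variables [x_j] and [y_i]: each
    coefficient of their product is a single composition. *)
Lemma ser_comp_lbar j j' i0 i0' b c b' c' (A : pred 'I_4) X e :
  j != j' -> (forall i, i = j \/ i = j') -> A i0 -> ~~ A i0' ->
  (forall i, ~~ A i -> b 0 i = 0 /\ c 0 i = 0) ->
  (forall i, A i -> b' 0 i = 0 /\ c' 0 i = 0) ->
  ser_comp (lbar j i0 b c) (lbar j' i0' b' c') (X, e) =
  lbar j i0 b c (X 0 j *: axis j, mask A e) \o
  lbar j' i0' b' c' (X 0 j' *: axis j', mask (predC A) e).
Proof.
move=> jj' jj'P Ai0 Ai0' bc bc'.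
have -> : (X 0 j' *: axis j', mask (predC A) e) =
    (X, e) - (X 0 j *: axis j, mask A e) :> expo.
  congr (_, _); last exact/esym/maskC.
  apply/rowP => i; rewrite !mxE eqxx /=; case: (jj'P i) => ->.
    by rewrite (negPf jj') eqxx mulr0 mulr1 subrr.
  by rewrite eqxx eq_sym (negPf jj') mulr0 mulr1 subr0.
apply: ser_comp_single => [w|[Y u] Yu]; first exact: lbar_vec0.
have [/eqP Yj|Yj] := boolP (Y == Y 0 j *: axis j); last first.
  by left; exact: lbar_axis0.
have [/eqP XYj|XYj] := boolP (X - Y == (X - Y) 0 j' *: axis j'); last first.
  by right; exact: lbar_axis0.
have [/forallP uA|] := boolP [forall i, ~~ A i ==> (u 0 i == 0)]; last first.
  move=> /forallPn[k]; rewrite negb_imply => /andP[Ak uk]; left.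
  have [bk ck] := bc _ Ak; apply: (@lbar_supp _ _ _ _ _ _ k) => //.
  by apply: contraNneq Ak => ->.
have [/forallP euA|] := boolP [forall i, A i ==> ((e - u) 0 i == 0)]; last first.
  move=> /forallPn[k]; rewrite negb_imply => /andP[Ak uk]; right.
  have [bk ck] := bc' _ Ak; apply: (@lbar_supp _ _ _ _ _ _ k) => //.
  by apply: contraNneq Ai0' => <-.
case/eqP: Yu; congr (_, _).
  rewrite Yj; congr (_ *: _); have := congr1 (fun Z : 'rV_2 => Z 0 j) XYj.
  rewrite !mxE eqxx (negPf jj') mulr0 /= => /eqP; rewrite subr_eq0 => /eqP -> //.
apply/rowP => i; rewrite mxE; case: ifP => Ai.
  have := euA i; rewrite Ai /= !mxE subr_eq0 => /eqP -> //.
by have := uA i; rewrite Ai => /eqP.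
Qed.

Local Notation y i := (delta_mx 0 i : 'rV[K]_4).
Local Notation first := (fun i : 'I_4 => (i < 2)%N).

Let y_ne (i j : 'I_4) : i != j -> (y j) 0 i = 0.
Proof. by move=> ij; rewrite mxE eqxx (negPf ij). Qed.

Let I2 (i : 'I_2) : i = 0 \/ i = 1.
Proof. by case: i => [[|[|//]] ?]; [left | right]; apply: val_inj. Qed.

(** Scalars added to two operators do not affect their commutator; [A], [A'] are
    the two compositions and [B], [C] the two operators, applied to [v]. *)
Lemma comm_shift (A A' B C v : V) (k1 k2 : K) :
  A - k2 *: B - k1 *: (C - k2 *: v) - (A' - k1 *: C - k2 *: (B - k1 *: v)) =
  A - A'.
Proof.
rewrite !scalerBr !scalerA [k2 * k1]mulrC.
move: (k2 *: B) (k1 *: C) ((k1 * k2) *: v) => x z w.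
rewrite -[A - x - _]addrA -opprD -[A' - z - _]addrA -opprD.
rewrite [z + (x - w)]addrCA; move: (x + _) => W.
by rewrite opprB addrA subrK.
Qed.

Lemma ser_comm_lbar X e v (N1 := X 0 0) (N2 := X 0 1) :
  ser_comm (lbar 0 0 (y 0) (y 1)) (lbar 1 2 (y 2) (y 3)) (X, e) v =
  lquad (y 0) (y 1) N1 (mask first e)
    (lquad (y 2) (y 3) N2 (mask (predC first) e) v) -
  lquad (y 2) (y 3) N2 (mask (predC first) e)
    (lquad (y 0) (y 1) N1 (mask first e) v).
Proof.
have yA i : ~~ first i -> (y 0) 0 i = 0 /\ (y 1) 0 i = 0.
  by move=> Ai; split; apply: y_ne; apply: contraNneq Ai => ->.
have yA' i : first i -> (y 2) 0 i = 0 /\ (y 3) 0 i = 0.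
  by move=> Ai; split; apply: y_ne; apply: contraTneq Ai => ->.
have E1 := @ser_comp_lbar 0 1 0 2 (y 0) (y 1) (y 2) (y 3) first X e.
have E2 := @ser_comp_lbar 1 0 2 0 (y 2) (y 3) (y 0) (y 1) (predC first) X e.
rewrite /ser_comm -[LHS]/(_ (X, e) v - _ (X, e) v) E1 // E2 //=; first last.
- by move=> i /negPn; exact: yA'.
- by move=> i; case: (I2 i); [right | left].
have -> : mask (predC (predC first)) e = mask first e.
  by apply/rowP => i; rewrite !mxE /= negbK.
have Xj j : X 0 j *: axis j == (X 0 j *: axis j) 0 j *: axis j.
  by rewrite !mxE !eqxx mulr1.
have XE (j : 'I_2) : (X 0 j *: axis j) 0 j = X 0 j by rewrite !mxE !eqxx mulr1.
rewrite !(lbarE _ _ _ _ _ (Xj _)) !XE.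
set k1 := lscal _ _ _ _ _; set k2 := lscal _ _ _ _ _.
rewrite !(linB (lquad_lin _ _ _ _)) !(linZ (lquad_lin _ _ _ _)) -/N1 -/N2.
exact: comm_shift.
Qed.

(** In the product with [delta (e^b x_1 / (e^c x_2))] the exponent of [x_1]
    selects the term of the delta series. *)
Lemma ser_scale_delta b c (F : expo -> V -> V) X e :
  (forall (Y : 'rV[int]_2) (u : 'rV[int]_4), Y 0 0 != 0 -> F (Y, u) = 0) ->
  ser_scale (delta_ser p b c) F (X, e) =
  if (p %| X 0%R 0%R)%Z then
    ser_scale (exp_lin ((X 0%R 0%R %/ p)%Z%:~R *: (b - c)))
      (fun u => F ((X 0 0 + X 0 1) *: axis 1, u)) e
  else 0.
Proof.
move=> F0; pose n := (X 0%R 0%R %/ p)%Z.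
pose Y0 : 'rV[int]_2 := (n * p%:Z) *: (axis 0 - axis 1).
have Y00 : Y0 0 0 = n * p%:Z by rewrite !mxE !eqxx /= subr0 mulr1.
have p_neq0 : p%:Z != 0 by move: p_gt0; lia.
pose t (w : expo) : V -> V := delta_ser p b c w *: F ((X, e) - w).
have t0 (Y : 'rV[int]_2) (u : 'rV[int]_4) : t (Y, u) <> 0 -> Y = Y0 /\ (p %| X 0%R 0%R)%Z.
  move=> tn0; have [Y0X|Y0X] := eqVneq (Y 0 0) (X 0 0); last first.
    case: tn0; rewrite /t -[(X, e) - (Y, u)]/(X - Y, e - u) F0 ?scaler0 //.
    by rewrite !mxE subr_eq0 eq_sym.
  have [[k Yk]|nYk] := pselect (exists k : int, Y = (k * p%:Z) *: (axis 0 - axis 1)).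
    have Xk : X 0 0 = k * p%:Z by rewrite -Y0X Yk !mxE !eqxx /= subr0 mulr1.
    by split; [rewrite Yk /Y0 /n Xk mulzK | rewrite Xk dvdz_mull].
  case: tn0; rewrite /t /delta_ser fsum0 ?scale0r // => k /=.
  by case: eqP => // Yk; case: nYk; exists k.
case: ifP => pX; last first.
  apply: fsum0 => -[Y u]; apply: contrapT => /t0[_].
  by rewrite pX.
rewrite /ser_scale -(fsbig_widen ((fun u => (Y0, u) : expo) @` [set: 'rV[int]_4])) //.
  rewrite fsbig_image; last by move=> u u' _ _ [].
  apply: eq_fsum => u; congr (_ *: F (_, _)).
    rewrite /delta_ser (fsum1 (i := n)) /= ?eqxx // => k kn.
    rewrite ifF //; apply: contraNF kn => /eqP/rowP/(_ 0).
    by rewrite Y00 !mxE !eqxx /= subr0 mulr1 => /(mulIf p_neq0) ->.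
  apply/rowP => i; have [->|->] := I2 i; rewrite !mxE /n divzK //=.
    by rewrite subr0 mulr1 mulr0 subrr.
  by rewrite sub0r mulrN1 opprK mulr1 addrC.
move=> [Y u] [_ Yu] /=; apply: contrapT => /t0[YE _]; apply: Yu.
by exists u; rewrite ?YE.
Qed.

Lemma lbar_deg i0 b c X (j : 'I_2) : deg_ge 2 (fun u => lbar j i0 b c (X, u)).
Proof.
move=> e e2; rewrite /lbar /= lquad_eq0 => [|M]; last first.
  by apply: exp_lin_deg; lia.
rewrite laurent_atE /deriv_z dimser_low ?(mulr0, mul0r); last lia.
by rewrite scale0r !if_same subrr.
Qed.

(** Multiplying by [e^s] adds [s] to the exponents in the quadratic part. *)
Lemma conv_lbar s b c T e v :
  ser_scale (exp_lin s) (fun u => lbar 1 0 b c (T *: axis 1, u)) e v =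
  2^-1 *: \sum_(M \in [set: int])
    exp_lin (s + expo_form b c T M) e *: nquad M (- T - M) v -
  (if T == 0 then
     2^-1 * ser_scale (exp_lin s) (laurent_at 0 (b - c) f' : _ -> K^o) e
   else 0) *: v.
Proof.
pose G u := lbar 1 0 b c (T *: axis 1, u).
have Gfin := conv_fin_supp s e (@lbar_deg 0 b c (T *: axis 1) 1).
rewrite /ser_scale (fsum_app _ Gfin).
have Tj : T *: axis 1 == (T *: axis 1) 0 1 *: axis 1 by rewrite !mxE !eqxx mulr1.
have T1 : (T *: axis 1) 0 1 = T by rewrite !mxE !eqxx mulr1.
have T0 : (T *: axis 1 == 0) = (T == 0).
  by apply/eqP/eqP => [/rowP/(_ 1)|->]; rewrite ?T1 ?mxE ?scale0r.
have [r nqr] := nquad_fin aH (- T) v.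
pose nonneg (u : 'rV[int]_4) : K^o := if \sum_i u 0 i < 0 then 0 else 1.
have nonneg_deg : deg_ge 0 nonneg by move=> u u0; rewrite /nonneg u0.
have [q qP] := conv_fin s e nonneg_deg.
have E0 (l : 'rV[K]_4) u : u \notin q -> exp_lin s u = 0 \/ exp_lin l (e - u) = 0.
  move=> /qP[->|]; [by left | rewrite /nonneg; case: ifP => [u0 _|_ /eqP]].
    by right; apply: exp_lin_deg.
  by rewrite oner_eq0.
pose E M u := exp_lin s u * exp_lin (expo_form b c T M) (e - u).
have EE M : \sum_(u \in [set: 'rV[int]_4]) E M u = exp_lin (s + expo_form b c T M) e.
  by rewrite -(exp_linD K0).
have Eq M u : u \notin q -> E M u = 0.
  by move=> /(E0 (expo_form b c T M))[]; rewrite /E => ->; rewrite ?mul0r ?mulr0.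
have lquadE u : exp_lin s u *: lquad b c T (e - u) v =
    2^-1 *: \sum_(M \in [set: int]) E M u *: nquad M (- T - M) v.
  rewrite /lquad /wquad scalerA mulrC -scalerA; congr (_ *: _).
  rewrite (fsumZ _ (wquad_fin aH _ _ _)); apply: eq_fsum => M.
  by rewrite scalerA.
pose k u : K^o := if T == 0 then 2^-1 * laurent_at 0 (b - c) f' u else 0.
have low2 : forall m : int, m < - 2%:Z -> f' m = 0.
  by move=> m m2; rewrite /deriv_z dimser_low ?mulr0 //; move: m2; lia.
have kdeg : deg_ge 2 k.
  by move=> u u2; rewrite /k (laurent_deg _ _ low2) // mulr0 if_same.
have termE u : (exp_lin s u *: lbar 1 0 b c (T *: axis 1, e - u)) v =
    2^-1 *: (\sum_(M \in [set: int]) E M u *: nquad M (- T - M) v) -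
    (exp_lin s u *: k (e - u)) *: v.
  rewrite -[LHS]/(exp_lin s u *: lbar 1 0 b c (T *: axis 1, e - u) v).
  by rewrite lbarE // T1 scalerBr lquadE scalerA /lscal T0.
under eq_fsum do rewrite termE.
have fin1 : fin_supp (fun u =>
    2^-1 *: \sum_(M \in [set: int]) E M u *: nquad M (- T - M) v).
  exists q => u uq; rewrite fsum0 ?scaler0 // => M.
  by rewrite Eq // scale0r.
have fin2 := conv_fin_supp s e kdeg.
have finv (w : V) (g : 'rV[int]_4 -> K) : fin_supp g -> fin_supp (fun u => g u *: w).
  by apply: fin_suppW => u ->; rewrite scale0r.
rewrite (fsumB fin1 (finv v _ fin2)); congr (_ - _).
  rewrite -fsumZ; last first.
    exists q => u uq; apply: fsum0 => M; by rewrite Eq // scale0r.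
  congr (_ *: _); rewrite (fsum_exchange (r := q) (s := r)); first last.
  - by move=> u M Mr; rewrite nqr // scaler0.
  - by move=> u M uq; rewrite Eq // scale0r.
  apply: eq_fsum => M; rewrite -EE.
  rewrite (fsum_morph (L := fun z => z *: nquad M (- T - M) v)) ?scale0r //.
    by move=> z z'; rewrite scalerDl.
  by exists q => u; exact: Eq.
rewrite -(fsum_morph (L := fun z => z *: v) (scale0r v) _ fin2); last first.
  by move=> z z'; rewrite scalerDl.
congr (_ *: _); rewrite /k; case: ifP => _; last by apply: fsum0 => u; rewrite scaler0.
rewrite /ser_scale mulr_fsumr; apply: eq_fsum => u; exact: mulrCA.
Qed.

(** The coefficients of one of the four terms of the right-hand side. *)
Lemma deriv_delta_lbar i b c b' c' X e v (T := X 0 0 + X 0 1)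
    (s := (X 0%R 0%R %/ p)%Z%:~R *: (b - c)) :
  deriv_y i (fun e => ser_scale (delta_ser p b c) (lbar 1 0 b' c') (X, e)) e v =
  if (p %| X 0%R 0%R)%Z then
    2^-1 *: \sum_(M \in [set: int])
      ((s + expo_form b' c' T M) 0 i * exp_lin (s + expo_form b' c' T M) e) *:
      nquad M (- T - M) v -
    (if T == 0 then 2^-1 *
       deriv_y i (ser_scale (exp_lin s) (laurent_at 0 (b' - c') f' : _ -> K^o)) e
     else 0) *: v
  else 0.
Proof.
have F0 (Y : 'rV[int]_2) (u : 'rV[int]_4) :
    Y 0 0 != 0 -> lbar 1 0 b' c' (Y, u) = 0.
  move=> Y0; apply: lbar_axis0; apply: contra Y0 => /eqP ->.
  by rewrite !mxE eqxx mulr0.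
rewrite -[LHS]/((e 0 i + 1)%:~R *:
  ser_scale (delta_ser p b c) (lbar 1 0 b' c') (X, e + delta_mx 0 i) v).
rewrite ser_scale_delta //; case: ifP => _; last exact: scaler0.
rewrite -/T -/s conv_lbar scalerBr; congr (_ - _).
  rewrite scalerA mulrC -scalerA; congr (_ *: _).
  rewrite fsumZ; last by apply: fin_suppW (nquad_fin aH (- T) v) => M ->; rewrite scaler0.
  by apply: eq_fsum => M; rewrite scalerA exp_linS.
rewrite scalerA; congr (_ *: _); case: ifP => _; last by rewrite mulr0.
exact: mulrCA.
Qed.

End Bracket.

Section BracketFormula.
Variables (K : fieldType) (h : lmodType K) (form : {symmetric h}) (p d : nat).
Variables (V : lmodType K) (a : h -> int -> V -> V) (P : int -> h -> h).
Variables (alpha : 'I_d -> h) (D : int -> K).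
Hypothesis K0 : [pchar K] =i pred0.
Hypothesis p_gt0 : (0 < p)%N.
Hypothesis aH : twisted_heisenberg form p a P alpha D.

Local Notation nquad := (nquad a alpha).
Local Notation lbar := (lbar p a alpha D).
Local Notation f' := (deriv_z (dimser p D)).
Local Notation y i := (delta_mx 0 i : 'rV[K]_4).
Local Notation first := (fun i : 'I_4 => (i < 2)%N).
Local Notation xform := (expo_form p).

Let pK : p%:R != 0 :> K.
Proof. by case: p p_gt0 => // n _; exact: natr_neq0. Qed.

Lemma bracket_shape (SA SB SC SD v : V) (qA qB qC qD : K) :
  - (2^-1 *: (2^-1 *: SA - (2^-1 * qA) *: v + (2^-1 *: SB - (2^-1 * qB) *: v))) -
    2^-1 *: (2^-1 *: SC - (2^-1 * qC) *: v + (2^-1 *: SD - (2^-1 * qD) *: v)) =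
  4^-1 *: (- (SA + SB + SC + SD) + (qA + qD + (qB + qC)) *: v).
Proof.
rewrite -!scalerA -!scalerBr -!scalerDr -!scalerN -!scalerDr !scalerA -!invfM -!natrM.
congr (_ *: _); rewrite !scalerN !scalerDl.
move: (qA *: v) (qB *: v) (qC *: v) (qD *: v) => A B C E.
have -> : SA - A + (SB - B) = SA + SB - (A + B) by rewrite addrACA opprD.
have -> : SC - C + (SD - E) = SC + SD - (C + E) by rewrite addrACA opprD.
rewrite !opprB addrACA -opprD addrC [in RHS]addrACA [E + C]addrC.
by rewrite [SA + SB + (_ + _)]addrA.
Qed.

(** Collects the four terms of the right-hand side: the quadratic parts and the
    scalar parts are compared separately. *)
Lemma bracket_assemble (N2 T : int) (u gA gB gC gD : int -> K)
    (an qA qB qC qD : K) v :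
  ((p %| N2)%Z -> forall M, u M = - (gA M + gB M + gC M + gD M)) ->
  ((p %| N2)%Z -> T = 0 -> an = qA + qD + (qB + qC)) ->
  (~~ (p %| N2)%Z -> ~~ (p %| T)%Z) ->
  let S (g : int -> K) := \sum_(M \in [set: int]) g M *: nquad M (- T - M) v in
  (if (p %| N2)%Z then 4^-1 *: (S u + (if T == 0 then an else 0) *: v) else 0) =
  - (2^-1 *: (2^-1 *: S gA - (if T == 0 then 2^-1 * qA else 0) *: v +
              (2^-1 *: S gB - (if T == 0 then 2^-1 * qB else 0) *: v))) -
    2^-1 *: (2^-1 *: S gC - (if T == 0 then 2^-1 * qC else 0) *: v +
              (2^-1 *: S gD - (if T == 0 then 2^-1 * qD else 0) *: v)).
Proof.
move=> uE anE pT S; pose q (x : K) : K := if T == 0 then x else 0.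
have qE x : (if T == 0 then 2^-1 * x else 0) = 2^-1 * q x.
  by rewrite /q; case: ifP => // _; rewrite mulr0.
rewrite !qE bracket_shape.
have [pN2|/pT {}pT] := boolP (p %| N2)%Z; last first.
  have T0 : (T == 0) = false by apply: contraNF pT => /eqP ->; rewrite dvdz0.
  have S0 g : S g = 0.
    apply: fsum0 => M.
    by rewrite (nquad_eq0 aH) ?scaler0 // subrKC dvdzE abszN -dvdzE.
  by rewrite !S0 /q T0 !addr0 oppr0 scale0r addr0 scaler0.
have nqfin (g : int -> K) : fin_supp (fun M => g M *: nquad M (- T - M) v).
  by apply: fin_suppW (nquad_fin aH (- T) v) => M ->; rewrite scaler0.
have SD g1 g2 : S g1 + S g2 = S (fun M => g1 M + g2 M).
  by rewrite /S -(fsumD (nqfin g1) (nqfin g2)); apply: eq_fsum => M; rewrite scalerDl.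
rewrite !SD; congr (_ *: (_ + _ *: v)).
  rewrite /S (fsumN (nqfin _)); apply: eq_fsum => M.
  by rewrite uE // scaleNr.
by rewrite /q; case: eqP => [T0|_]; [exact: anE | rewrite !addr0].
Qed.

Lemma split_xform N1 M1 N2 M2 e :
  exp_lin (xform (y 0) (y 1) N1 M1) (mask first e) *
  exp_lin (xform (y 2) (y 3) N2 M2) (mask (predC first) e) =
  exp_lin (xform (y 0) (y 1) N1 M1 + xform (y 2) (y 3) N2 M2) e.
Proof.
apply: exp_lin_split => i Ai; rewrite !mxE eqxx /=.
  have -> : (i == 0) = false by apply: contraNF Ai => /eqP ->.
  have -> : (i == 1) = false by apply: contraNF Ai => /eqP ->.
  by rewrite !mulr0 subrr.
have -> : (i == 2) = false by apply: contraTF Ai => /eqP ->.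
have -> : (i == 3) = false by apply: contraTF Ai => /eqP ->.
by rewrite !mulr0 subrr.
Qed.

Lemma bracket_lbar X e v :
  ser_comm (lbar 0 0 (y 0) (y 1)) (lbar 1 2 (y 2) (y 3)) (X, e) v =
  - (2^-1 *:
     (deriv_y 0 (fun e => ser_scale (delta_ser p (y 0) (y 2))
        (lbar 1 0 (- y 0 + y 1 + y 2) (y 3)) (X, e)) e v +
      deriv_y 0 (fun e => ser_scale (delta_ser p (y 0) (y 3))
        (lbar 1 0 (- y 0 + y 1 + y 3) (y 2)) (X, e)) e v)) -
  2^-1 *:
     (deriv_y 1 (fun e => ser_scale (delta_ser p (y 1) (y 2))
        (lbar 1 0 (y 0 - y 1 + y 2) (y 3)) (X, e)) e v +
      deriv_y 1 (fun e => ser_scale (delta_ser p (y 1) (y 3))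
        (lbar 1 0 (y 0 - y 1 + y 3) (y 2)) (X, e)) e v).
Proof.
rewrite (ser_comm_lbar aH) /lquad (wquad_comm aH) !(deriv_delta_lbar K0 p_gt0 aH).
set N1 := X 0 0; set N2 := X 0 1; set T := N1 + N2.
have [pN1|pN1] := boolP (p %| N1)%Z; last first.
  rewrite !addr0 !scaler0 oppr0 addr0; case: ifP => // pN2.
  have pT : ~~ (p %| T)%Z by rewrite /T rpredDr.
  rewrite fsum0 => [|M]; last first.
    by rewrite (nquad_eq0 aH) ?scaler0 // subrKC dvdzE abszN -dvdzE.
  rewrite ifF ?scale0r ?addr0 ?scaler0 //.
  by apply: contraNF pT => /eqP ->; rewrite dvdz0.
set n := (N1 %/ p)%Z.
have N1E : N1 = n * p%:Z by rewrite divzK.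
have N1K : N1%:~R = n%:~R * p%:R :> K by rewrite N1E rmorphM.
have TK : T%:~R = n%:~R * p%:R + N2%:~R :> K by rewrite /T rmorphD /= N1K.
(* each term of the right-hand side has the exponents of one of the four terms
   of the expanded product of weights in wquad_comm *)
have intE := (rmorphD, rmorphN, TK, N1K).
apply: bracket_assemble => [pN2 M|pN2 T0|pN2]; last by rewrite /T rpredDl.
  have -> : n%:~R *: (y 0 - y 2) + xform (- y 0 + y 1 + y 2) (y 3) T M =
      xform (y 0) (y 1) N1 (- N1 - M) + xform (y 2) (y 3) N2 (N1 + M).
    by apply/rowP => i; rewrite !mxE !intE /= !intE; field.
  have -> : n%:~R *: (y 0 - y 3) + xform (- y 0 + y 1 + y 3) (y 2) T M =
      xform (y 0) (y 1) N1 (- N1 - M) + xform (y 2) (y 3) N2 (- T - M).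
    by apply/rowP => i; rewrite !mxE !intE /= !intE; field.
  have -> : n%:~R *: (y 1 - y 2) + xform (y 0 - y 1 + y 2) (y 3) T M =
      xform (y 0) (y 1) N1 M + xform (y 2) (y 3) N2 (N1 + M).
    by apply/rowP => i; rewrite !mxE !intE /= !intE; field.
  have -> : n%:~R *: (y 1 - y 3) + xform (y 0 - y 1 + y 3) (y 2) T M =
      xform (y 0) (y 1) N1 M + xform (y 2) (y 3) N2 (- T - M).
    by apply/rowP => i; rewrite !mxE !intE /= !intE; field.
  have x0 M1 M2 : (xform (y 0) (y 1) N1 M1 + xform (y 2) (y 3) N2 M2) 0 0 =
      - (M1%:~R / p%:R).
    by rewrite !mxE /=; ring.
  have x1 M1 M2 : (xform (y 0) (y 1) N1 M1 + xform (y 2) (y 3) N2 M2) 0 1 =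
      - ((- N1 - M1)%:~R / p%:R).
    by rewrite !mxE /=; ring.
  rewrite mulrDl !mulrDr !split_xform !x0 !x1; ring.
have N2E : N2 = - N1 by move: T0; rewrite /T; lia.
pose b (M : int) : K := (M%:~R / p%:R) * ((- N1 - M)%:~R / p%:R) * D M *
    ((0 < M)%R%:R - (0 < M + N1)%R%:R).
have bfin : fin_supp b.
  apply: (@fin_supp_int _ (absz N1)) => M MB; rewrite /b.
  have -> : (0 < M + N1) = (0 < M) by move: MB; lia.
  by rewrite subrr mulr0.
have bfinE (g : int -> K) : fin_supp (fun M => b M * g M).
  by apply: fin_suppW bfin => M ->; rewrite mul0r.
have two (i j : 'I_4) : i != 0 -> i != 1 -> j != 0 -> j != 1 ->
  deriv_y 0 (ser_scale (exp_lin (n%:~R *: (y 0 - y i)))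
    (laurent_at 0 (- y 0 + y 1 + y i - y j) f' : _ -> K^o)) e +
  deriv_y 1 (ser_scale (exp_lin (n%:~R *: (y 1 - y j)))
    (laurent_at 0 (y 0 - y 1 + y j - y i) f' : _ -> K^o)) e =
  \sum_(M \in [set: int]) b M * exp_lin (- (M%:~R / p%:R) *: (y 0 - y i) +
             ((N1 + M)%:~R / p%:R) *: (y 1 - y j)) e.
  move=> i0 i1 j0 j1.
  have := scalar_terms K0 p_gt0 (heis_period aH) (heis_opp aH) n e i0 i1 j0 j1.
  by rewrite -N1E.
rewrite !two // -(fsumD (bfinE _) (bfinE _)) /anomaly; apply: eq_fsum => M.
rewrite -mulrDr [exp_lin _ _ * (_ + _)]mulrDr !split_xform /b -[RHS]mulrA.
congr (_ * (_ * _)); congr (_ + _); congr (exp_lin _ _).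
  by apply/rowP => i; rewrite !mxE N2E !intE /= !intE; field.
by apply/rowP => i; rewrite !mxE N2E !intE /= !intE; field.
Qed.

(** Partial derivative of a series of operators. *)
Definition op_deriv_y (i : 'I_4) (F : expo -> V -> V) : expo -> V -> V :=
  fun Xe => deriv_y i (fun e => F (Xe.1, e)) Xe.2.

Lemma bracket_formula :
  ser_comm (lbar 0 0 (y 0) (y 1)) (lbar 1 2 (y 2) (y 3)) =
  - (2^-1 *: op_deriv_y 0
       (ser_scale (delta_ser p (y 0) (y 2)) (lbar 1 0 (- y 0 + y 1 + y 2) (y 3)) +
        ser_scale (delta_ser p (y 0) (y 3)) (lbar 1 0 (- y 0 + y 1 + y 3) (y 2))))
  - 2^-1 *: op_deriv_y 1
       (ser_scale (delta_ser p (y 1) (y 2)) (lbar 1 0 (y 0 - y 1 + y 2) (y 3)) +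
        ser_scale (delta_ser p (y 1) (y 3)) (lbar 1 0 (y 0 - y 1 + y 3) (y 2))).
Proof.
apply/funext => -[X e]; apply/funext => v; rewrite bracket_lbar.
have derivD i (F G : expo -> V -> V) : op_deriv_y i (F + G) (X, e) v =
    deriv_y i (fun e => F (X, e)) e v + deriv_y i (fun e => G (X, e)) e v.
  exact: scalerDr.
by rewrite -!derivD.
Qed.

End BracketFormula.

(** * The bracket formula on the twisted Fock space *)

Section TwistedFock.
Variables (K : fieldType) (h : vectType K) (form : {symmetric h}).
Variables (nu : 'End(h)) (omega : K) (p d : nat) (alpha : d.-tuple h).
Hypothesis K0 : [pchar K] =i pred0.
Hypothesis omega_prim : p.-primitive_root omega.
Hypothesis nu_isom : isometry form form nu.
Hypothesis nu_period : forall x, iter p nu x = x.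
Hypothesis alpha_basis : basis_of {:h} alpha.
Hypothesis alpha_orthonormal : forall q r : 'I_d,
  form (tnth alpha q) (tnth alpha r) = (q == r)%:R.

Let p_gt0 : (0 < p)%N. Proof. exact: prim_order_gt0 omega_prim. Qed.

Let pK : p%:R != 0 :> K.
Proof. by case: p p_gt0 => // n _; exact: natr_neq0. Qed.

Local Notation mode := (@mode K h form nu omega p).

(** Dimension of the eigenspace of degree [M]. *)
Definition eig_dim (M : int) : K := (\dim (eig nu omega M))%:R.

Lemma fock_heisenberg : twisted_heisenberg form p mode
  (fun M x => eig_proj nu omega p M x) (tnth alpha) eig_dim.
Proof.
split.
- exact: mode_linearr.
- exact: mode_linearl.
- exact: mode_comm.
- exact: mode_proj.
- exact: mode_nilpotent.
- exact: eig_proj_adj.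
- exact: orthonormal_exp.
- exact: sum_form_eig_proj.
- move=> M N MN; rewrite /eig_dim (@eig_mod _ _ nu _ _ omega_prim M N) //.
  by apply/eqP; rewrite eqz_mod_dvd.
Qed.

Lemma dim_seriesE : dim_series nu omega p = dimser p eig_dim.
Proof. by apply/funext => m; rewrite /dim_series fct_sumE. Qed.

Lemma LbarE j i0 b c :
  Lbar form nu omega p alpha j i0 b c = lbar p mode (tnth alpha) eig_dim j i0 b c.
Proof. by rewrite /Lbar dim_seriesE. Qed.

End TwistedFock.

Theorem proposition7p2 (R : realType) (d p : nat) (h : vectType R[i])
    (form : {symmetric h}) (nu : 'End(h)) (omega : R[i]) (lat : set h)
    (alpha : d.-tuple h)
    (dim_h : \dim {:h} = d)
    (form_nondeg : nondegenerate form)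
    (p_gt0 : (0 < p)%N)
    (omega_prim : p.-primitive_root omega)
    (nu_isom : isometry form form nu)
    (nu_period : forall x, iter p nu x = x)
    (lat_rational : rational_lattice form lat)
    (lat_nu : nu @` lat = lat)
    (alpha_basis : basis_of {:h} alpha)
    (alpha_orthonormal : forall q r : 'I_d,
       form (tnth alpha q) (tnth alpha r) = (q == r)%:R) :
  let y1 : 'rV[R[i]]_4 := delta_mx 0 0 in
  let y2 : 'rV[R[i]]_4 := delta_mx 0 1 in
  let y3 : 'rV[R[i]]_4 := delta_mx 0 2 in
  let y4 : 'rV[R[i]]_4 := delta_mx 0 3 in
  let L := Lbar form nu omega p alpha in
  ser_comm (L 0 0 y1 y2) (L 1 2 y3 y4) =
  - (2^-1 *: pderiv_y 0
       (ser_scale (delta_ser p y1 y3) (L 1 0 (- y1 + y2 + y3) y4) +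
        ser_scale (delta_ser p y1 y4) (L 1 0 (- y1 + y2 + y4) y3)))
  - 2^-1 *: pderiv_y 1
       (ser_scale (delta_ser p y2 y3) (L 1 0 (y1 - y2 + y3) y4) +
        ser_scale (delta_ser p y2 y4) (L 1 0 (y1 - y2 + y4) y3)).
Proof.
move=> y1 y2 y3 y4 L.
have K0 : [pchar R[i]] =i pred0 by exact: pchar_num.
have aH := fock_heisenberg K0 omega_prim nu_isom nu_period alpha_basis
  alpha_orthonormal.
rewrite /L !LbarE.
exact: (bracket_formula K0 p_gt0 aH).
Qed.
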